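(* There exists a compact plane set $K$ such that $R(K)$ is weakly strongly regular and such that for every integer $m\geq 2$ there exists a point $x\in K$ such that, in $R(K)$, $\overline{J_x}\supset M_x^m$ but $\overline{J_x}\not\supset M_x^{m-1}$.
   Context: A compact plane set is a nonempty compact subset of $\mathbb{C}$. For a compact plane set $K$, $R(K)$ denotes the uniform closure on $K$ of the rational functions with poles off $K$; it is a uniform algebra on $K$ (a closed subalgebra of $C(K)$, with sup norm, containing the constants and separating points). For a uniform algebra $A$ on a compact Hausdorff space $X$ and $x\in X$: $M_x=\{f\in A: f(x)=0\}$ and $J_x=\{f\in A: f^{-1}(0)\text{ contains a neighborhood of }x\text{ in }X\}$. Bars denote closure in $A$. $M_x^m$ is the usual $m$th power of the ideal $M_x$ (the linear span of products of $m$ elements of $M_x$). $A$ is weakly strongly regular at $x$ if there exists $m\in\mathbb{N}=\{1,2,\dots\}$ such that $\overline{J_x}\supset M_x^m$; $A$ is weakly strongly regular if it is weakly strongly regular at every point of $X$. *)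

(* Defs.v *)
From HB Require Import structures.
From mathcomp Require Import all_boot all_order all_algebra.
From mathcomp Require Import all_classical all_reals.
From mathcomp Require Import topology normedtype.
From mathcomp Require Import complex.

Set Implicit Arguments.
Unset Strict Implicit.
Unset Printing Implicit Defensive.

Import Order.TTheory GRing.Theory Num.Theory.
Import numFieldNormedType.Exports.

Local Open Scope classical_set_scope.
Local Open Scope ring_scope.

Section LinearSpan.
Variables (F : nzRingType) (V : lmodType F).

Definition linear_span (S : set V) : set V :=
  [set v | exists (n : nat) (c : 'I_n -> F) (s : 'I_n -> V),
     (forall i, S (s i)) /\ v = \sum_(i < n) c i *: s i].

End LinearSpan.

(* A function algebra A on X is represented by the set of its elements; the    *)
(* algebra operations are the pointwise ones of X -> F^o. The topology of      *)
(* {uniform X -> F^o} is the one given by the sup norm on bounded functions.   *)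
Section FunctionAlgebra.
Variables (F : numFieldType) (X : topologicalType).
Implicit Types (A S : set (X -> F^o)) (x : X) (m : nat).

Definition uniform_closure S : set (X -> F^o) :=
  closure (S : set {uniform X -> F^o}).

Definition closure_in A S : set (X -> F^o) := A `&` uniform_closure S.

Definition M_ideal A x : set (X -> F^o) := A `&` [set f | f x = 0].

Definition J_ideal A x : set (X -> F^o) :=
  A `&` [set f | nbhs x (f @^-1` [set 0])].

(* Only meaningful for 0 < m: for m = 0 this is the set of constants.          *)
Definition ideal_power S m : set (X -> F^o) :=
  linear_span [set h | exists g : 'I_m -> (X -> F^o),
     (forall i, S (g i)) /\ h = \prod_(i < m) g i].

Definition power_in_closure A x m : Prop :=
  ideal_power (M_ideal A x) m `<=` closure_in A (J_ideal A x).

Definition weakly_strongly_regular_at A x : Prop :=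
  exists2 m : nat, (0 < m)%N & power_in_closure A x m.

Definition weakly_strongly_regular A : Prop :=
  forall x, weakly_strongly_regular_at A x.

End FunctionAlgebra.

(* The complex plane is R[i]^o: this alias of R[i] carries the topology of the *)
(* modulus. A set K coerces to the type of its points, which carries the       *)
(* induced topology, so that functions on K are genuine functions K -> C.      *)
Section PlaneSets.
Variable R : realType.
Implicit Type K : set R[i]^o.

Definition compact_plane_set K : Prop := K !=set0 /\ compact K.

Definition rational_functions K : set (K -> R[i]^o) :=
  [set f | exists p q : {poly R[i]},
     (forall z : R[i], K z -> q.[z] != 0) /\
     (forall z : K, f z = p.[set_val z] / q.[set_val z])].

Arguments rational_functions K : clear implicits.

Definition RK K : set (K -> R[i]^o) :=
  uniform_closure (rational_functions K).

End PlaneSets.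

Arguments rational_functions {R} K.
Arguments RK {R} K.

(* Main.v *)
(* K is a Swiss cheese: the closed discs of centre p_j = 4^-j and radius
   4^-j / 8, together with their limit 0, minus countably many small open discs
   (holes). The holes are arranged in barriers. The barrier of centre a, radius
   r and strength eps consists of holes, of radius proportional to r * eps, at
   the points a + r * rho_k * u, where u runs over the N_k-th roots of unity and
   rho_k decreases to 1. With w = (z - a) / r, the product over k of the
   functions w^N_k / (w^N_k - rho_k^N_k), whose poles lie in the holes, converges
   uniformly on K to some H in R(K) with H = 0 for |w| <= 1, |H| = O(1 / eps),
   and |H - 1| <= 1 / |w| for |w| >= 2. If x lies in the disc of the barrier,
   then H is in J_x and |(1 - H) (z - x)^m| is small as soon as r^m / eps and r
   are small, and this gives M_x^m inside the closure of J_x.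

   At p_j there are barriers of radius r -> 0 and of strength about r^(j+1), so
   m = j + 2 works. Every other x in the j-th disc is in a barrier of centre a
   and arbitrarily small radius r, whose strength is |a - p_j|^(j+2) times a
   fixed power of r up to constants, so m = 5 works there. At 0 the discs are
   separated by circles around 0 and m = 1 works.

   Conversely m = j + 1 fails at p = p_j, because the radii s_h and centres c_h of
   the holes in the j-th disc satisfy sum s_h / |c_h - p|^(j+2) <= 1/16: if a
   rational function f is close to (z - p)^(j+1) on K and close to 0 near p,
   then Cauchy's theorem for (f - (z - p)^(j+1)) / (z - p)^(j+2) on an annulus
   around p with the holes removed is violated, since the small circle
   contributes -1. Contour integrals are replaced by averages over roots of
   unity, for which Cauchy's theorem holds in the limit for rational functions. *)
Require Import Defs.
From HB Require Import structures.
From mathcomp Require Import all_boot all_order all_algebra.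
From mathcomp Require Import all_classical all_reals.
From mathcomp Require Import topology normedtype.
From mathcomp Require Import complex.
From mathcomp Require Import finmap cyclic separable cyclotomic ring lra zify.

Set Implicit Arguments.
Unset Strict Implicit.
Unset Printing Implicit Defensive.

Import Order.TTheory GRing.Theory Num.Theory.
Import numFieldNormedType.Exports.

Local Open Scope classical_set_scope.
Local Open Scope ring_scope.
Local Open Scope complex_scope.

Notation nm := Normc.normc.

(** * The modulus of complex numbers *)

Section Modulus.
Variable R : realType.
Local Notation C := R[i].
Implicit Types (x y z : C) (r : R).

Lemma normC_nm z : `|z| = (nm z)%:C.
Proof. by case: z. Qed.

Lemma nm_ge0 z : 0 <= nm z.
Proof. by rewrite -lecR -normC_nm; exact: normr_ge0. Qed.

Lemma nm0 : nm (0 : C) = 0.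
Proof. exact: Normc.normc0. Qed.

Lemma nm1 : nm (1 : C) = 1.
Proof. exact: Normc.normc1. Qed.

Lemma nmM x y : nm (x * y) = nm x * nm y.
Proof. exact: Normc.normcM. Qed.

Lemma nmV x : nm x^-1 = (nm x)^-1.
Proof. exact: Normc.normcV. Qed.

Lemma nmN x : nm (- x) = nm x.
Proof. exact: normcN. Qed.

Lemma nmD x y : nm (x + y) <= nm x + nm y.
Proof. exact: le_normcD. Qed.

Lemma nmB x y : nm (x - y) <= nm x + nm y.
Proof. by rewrite -(nmN y) nmD. Qed.

Lemma nmC x y : nm (x - y) = nm (y - x).
Proof. by rewrite -nmN opprB. Qed.

Lemma nm_dist x y z : nm (x - z) <= nm (x - y) + nm (y - z).
Proof. by have := nmD (x - y) (y - z); rewrite addrA subrK. Qed.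

Lemma nm_subl x y : nm x - nm y <= nm (x - y).
Proof. by rewrite lerBlDr -{1}(subrK y x) nmD. Qed.

Lemma nmX x n : nm (x ^+ n) = nm x ^+ n.
Proof. by elim: n => [|n IH]; rewrite ?expr0 ?nm1 // !exprS nmM IH. Qed.

Lemma nm_eq0 z : (nm z == 0) = (z == 0).
Proof.
by apply/eqP/eqP => [|->]; [exact: Normc.eq0_normc | rewrite nm0].
Qed.

Lemma nm_gt0 z : (0 < nm z) = (z != 0).
Proof. by rewrite lt_def nm_ge0 andbT nm_eq0. Qed.

Lemma nm_real r : nm (r%:C) = `|r|.
Proof. by rewrite /= expr0n addr0 sqrtr_sqr. Qed.

Lemma nm_nat n : nm (n%:R : C) = n%:R.
Proof. by rewrite -(rmorph_nat (real_complex R)) nm_real normr_nat. Qed.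

Lemma nm_sum (I : Type) (s : seq I) (P : pred I) (F : I -> C) :
  nm (\sum_(i <- s | P i) F i) <= \sum_(i <- s | P i) nm (F i).
Proof.
elim/big_ind2: _ => [|x1 x2 y1 y2 h1 h2|//]; first by rewrite nm0.
by apply: le_trans (nmD _ _) _; apply: lerD.
Qed.

Lemma nm_prod (I : Type) (s : seq I) (P : pred I) (F : I -> C) :
  nm (\prod_(i <- s | P i) F i) = \prod_(i <- s | P i) nm (F i).
Proof. by apply: (big_morph (fun z : C => nm z) nmM nm1). Qed.

Lemma nm_re z : `|complex.Re z| <= nm z.
Proof. by rewrite -lecR -normC_nm normc_ge_Re. Qed.

Lemma nm_im z : `|complex.Im z| <= nm z.
Proof.
case: z => a b /=; rewrite -sqrtr_sqr; apply: ler_wsqrtr.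
by rewrite lerDr sqr_ge0.
Qed.

Lemma nm_le_re_im z : nm z <= `|complex.Re z| + `|complex.Im z|.
Proof.
case: z => a b /=; rewrite -(ger0_norm (addr_ge0 (normr_ge0 a) (normr_ge0 b))).
rewrite -sqrtr_sqr; apply: ler_wsqrtr.
rewrite sqrrD !real_normK ?num_real // lerD2r lerDl.
by rewrite mulrn_wge0 // mulr_ge0.
Qed.

End Modulus.

(** * Averages over roots of unity *)

Section RootsOfUnity.
Variable R : realType.
Local Notation C := R[i].

(** X^N - 1 is separable in characteristic 0, so it has N distinct roots, and these include a
    primitive one. The premise sits under the quantifier so that [zeta] is total. *)
Lemma exists_primitive_root (N : nat) :
  exists z : C, (0 < N)%N -> N.-primitive_root z.
Proof.
case: N => [|n]; first by exists 0.
set p : {poly C} := 'X^(n.+1) - 1.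
have [rs prs] := closed_field_poly_normal p.
have p_monic : lead_coef p = 1 by apply/eqP; rewrite -monicE; exact: monicXnsubC.
move: prs; rewrite p_monic scale1r => prs.
have szrs : size rs = n.+1.
  have := size_XnsubC (1 : C) (ltn0Sn n); rewrite -/p prs size_prod_XsubC.
  by move=> [].
have sep : separable_poly p.
  by apply: separable_Xn_sub_1; rewrite pnatr_eq0.
have urs : uniq rs by rewrite -separable_prod_XsubC -prs.
have /hasP[z _ zP] : has (n.+1).-primitive_root rs.
  apply: has_prim_root => //; last by rewrite szrs.
  apply/allP => z zrs; rewrite unity_rootE.
  have : root p z by rewrite prs root_prod_XsubC.
  by rewrite /p rootE !hornerE subr_eq0.
by exists z.
Qed.

Definition zeta (N : nat) : C := projT1 (cid (exists_primitive_root N)).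

Lemma zetaP N : (0 < N)%N -> N.-primitive_root (zeta N).
Proof. exact: (projT2 (cid (exists_primitive_root N))). Qed.

Lemma zeta_exp N : (0 < N)%N -> zeta N ^+ N = 1.
Proof. by move=> /zetaP /prim_expr_order. Qed.

Lemma nm_zeta N : (0 < N)%N -> nm (zeta N) = 1.
Proof.
move=> N0; have := zeta_exp N0 => /(congr1 (fun z : C => nm z)).
rewrite nmX nm1 -[X in _ = X -> _](expr1n R N) => /eqP.
by rewrite eqrXn2 ?nm_ge0 // => /eqP.
Qed.

Lemma sum_zeta N k : (0 < N)%N ->
  \sum_(i < N) (zeta N ^+ i) ^+ k = if (N %| k)%N then N%:R else 0.
Proof.
move=> N0; have zP := zetaP N0.
under eq_bigr do rewrite exprAC.
rewrite (prim_order_dvd zP); case: eqVneq => [->|zk1].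
  by under eq_bigr do rewrite expr1n; rewrite sumr_const card_ord.
have := subrX1 (zeta N ^+ k) N; rewrite exprAC zeta_exp // expr1n subrr.
move=> /esym/eqP; rewrite mulf_eq0 subr_eq0 (negbTE zk1) /= => /eqP.
by [].
Qed.

(* [circ_avg N c r G] is the Riemann sum of [(2 i pi)^-1] times the contour
   integral of [G] over the circle of centre [c] and radius [r], with the
   [N]-th roots of unity as nodes. *)
Definition circ_avg (N : nat) (c : C) (r : R) (G : C -> C) : C :=
  N%:R^-1 * \sum_(i < N) G (c + r%:C * zeta N ^+ i) * (r%:C * zeta N ^+ i).

Lemma circ_avgD N c r G1 G2 :
  circ_avg N c r (fun z => G1 z + G2 z) = circ_avg N c r G1 + circ_avg N c r G2.
Proof.
rewrite /circ_avg -mulrDr -big_split /=; congr (_ * _).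
by apply: eq_bigr => i _; rewrite mulrDl.
Qed.

Lemma circ_avgZ N c r a G :
  circ_avg N c r (fun z => a * G z) = a * circ_avg N c r G.
Proof.
rewrite /circ_avg mulrCA; congr (_ * _); rewrite mulr_sumr.
by apply: eq_bigr => i _; rewrite -mulrA.
Qed.

Lemma nm_node N c r i : 0 <= r -> (0 < N)%N ->
  nm (c + r%:C * zeta N ^+ i - c) = r.
Proof.
move=> r0 N0; rewrite addrC addKr nmM nmX nm_zeta // expr1n mulr1 nm_real.
by rewrite ger0_norm.
Qed.

(** Only the nodes are tested because [ring_factor_bound] controls its integrand at the nodes
    alone. *)
Lemma nm_circ_avg_nodes N c r G M : 0 <= r -> (0 < N)%N ->
  (forall i, (i < N)%N -> nm (G (c + r%:C * zeta N ^+ i)) <= M) ->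
  nm (circ_avg N c r G) <= r * M.
Proof.
move=> r0 N0 GM; rewrite /circ_avg nmM nmV nm_nat ler_pdivrMl ?ltr0n //.
apply: le_trans (nm_sum _ _ _) _.
have -> : N%:R * (r * M) = \sum_(i < N) M * r.
  by rewrite mulr_natl sumr_const card_ord mulrC.
apply: ler_sum => i _; rewrite nmM.
have -> : nm (r%:C * zeta N ^+ i) = r.
  by rewrite -[RHS](nm_node c i r0 N0) addrC addKr.
by apply: ler_wpM2r => //; exact: GM.
Qed.

Lemma nm_circ_avg N c r G M : 0 <= r -> (0 < N)%N ->
  (forall z, nm (z - c) = r -> nm (G z) <= M) ->
  nm (circ_avg N c r G) <= r * M.
Proof.
by move=> r0 N0 GM; apply: nm_circ_avg_nodes => // i _; apply: GM; exact: nm_node.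
Qed.

(** For a node c + x and u = a - c, the identity x^N = r^N makes x / (x - u) equal to (r^N - u^N)^-1
    times the sum of x^(N-j) u^j over j < N; averaging over the roots of unity keeps only j = 0. *)
Lemma circ_avg_pole_neq N c r a : 0 <= r -> (0 < N)%N ->
  r%:C ^+ N - (a - c) ^+ N != 0 ->
  circ_avg N c r (fun z => (z - a)^-1) =
  r%:C ^+ N / (r%:C ^+ N - (a - c) ^+ N).
Proof.
move=> r0 N0; set u := a - c => den.
have E (i : nat) : (c + r%:C * zeta N ^+ i - a)^-1 * (r%:C * zeta N ^+ i) =
   (r%:C ^+ N - u ^+ N)^-1 *
   \sum_(j < N) (r%:C ^+ (N - j) * u ^+ j) * (zeta N ^+ i) ^+ (N - j).
  set x := r%:C * zeta N ^+ i.
  have xN : x ^+ N = r%:C ^+ N by rewrite exprMn exprAC zeta_exp // expr1n mulr1.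
  have -> : c + x - a = x - u by rewrite /u opprB addrA (addrC c).
  have xu : x - u != 0.
    by rewrite subr_eq0; apply: contraNneq den => <-; rewrite xN subrr.
  apply: (mulfI den); apply: (mulfI xu).
  rewrite mulVKf // mulrCA mulVKf //.
  transitivity ((x - u) * (\sum_(j < N) x ^+ (N.-1 - j) * u ^+ j) * x).
    by rewrite -subrXX xN.
  rewrite -mulrA; congr (_ * _); rewrite mulr_suml; apply: eq_bigr => j _.
  rewrite mulrAC -exprSr mulrAC -exprMn -/x; congr (_ ^+ _ * _).
  by have := ltn_ord j; lia.
rewrite /circ_avg; under eq_bigr do rewrite E.
rewrite -mulr_sumr mulrCA mulrC; congr (_ * _).
rewrite exchange_big /=.
case: N N0 {den E} => // n N0.
rewrite big_ord_recl [X in _ + X]big1 ?addr0 => [|j _].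
  rewrite -mulr_sumr sum_zeta // subn0 dvdnn expr0 mulr1 mulrC mulfK //.
  by rewrite pnatr_eq0.
have := ltn_ord j; rewrite /= /bump => jn.
by rewrite -mulr_sumr sum_zeta // gtnNdvd ?mulr0 //; lia.
Qed.

Lemma circ_avg_pole N c r a : 0 <= r -> (0 < N)%N -> nm (a - c) != r ->
  circ_avg N c r (fun z => (z - a)^-1) =
  r%:C ^+ N / (r%:C ^+ N - (a - c) ^+ N).
Proof.
move=> r0 N0 ar; apply: circ_avg_pole_neq => //.
rewrite subr_eq0; apply: contra ar => /eqP /(congr1 (fun z : C => nm z)).
rewrite !nmX nm_real ger0_norm // => /eqP.
by rewrite eqrXn2 ?nm_ge0 // eq_sym.
Qed.

(** After recentring at [c], all exponents lie strictly between 0 and N, so each sum over the roots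
    of unity is exactly 0. *)
Lemma circ_avg_poly c r (p : {poly C}) N : 0 <= r -> (size p < N)%N ->
  circ_avg N c r (fun z => p.[z]) = 0.
Proof.
move=> r0 pN; have N0 : (0 < N)%N by apply: leq_ltn_trans pN.
pose q := p \Po ('X + c%:P).
have szq : (size q <= size p)%N.
  rewrite /q; have [->|p0] := eqVneq p 0; first by rewrite comp_poly0 size_poly0.
  by rewrite size_comp_poly2 // size_XaddC.
have E (i : nat) : p.[c + r%:C * zeta N ^+ i] * (r%:C * zeta N ^+ i) =
  \sum_(j < size q) (q`_j * r%:C ^+ j.+1) * (zeta N ^+ i) ^+ j.+1.
  rewrite -[c + _]addrC.
  have -> : p.[r%:C * zeta N ^+ i + c] = q.[r%:C * zeta N ^+ i].
    by rewrite /q horner_comp !hornerE.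
  rewrite horner_coef mulr_suml; apply: eq_bigr => j _.
  by rewrite -[RHS]mulrA -(exprMn j.+1) -mulrA; congr (_ * _); rewrite exprSr.
rewrite /circ_avg; under eq_bigr do rewrite E.
rewrite exchange_big /= big1 ?mulr0 // => j _.
rewrite -mulr_sumr sum_zeta // gtnNdvd ?mulr0 //.
by apply: leq_ltn_trans pN; apply: leq_trans szq.
Qed.

End RootsOfUnity.

(** * Cauchy's theorem for rational functions *)

Section Vanishing.
Variable R : realType.
Local Notation C := R[i].
Implicit Types (x y e r : R) (u v : nat -> C) (a c z : C).

Lemma bernoulli_ge x n : 0 <= x -> 1 + n%:R * x <= (1 + x) ^+ n.
Proof.
move=> x0; elim: n => [|n IH]; first by rewrite mul0r addr0 expr0.
rewrite exprS; apply: (@le_trans _ _ ((1 + x) * (1 + n%:R * x))).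
  rewrite -natr1; have : 0 <= n%:R * x * x by rewrite !mulr_ge0.
  lra.
by rewrite ler_wpM2l // addr_ge0.
Qed.

Lemma expr_small x e : 0 <= x < 1 -> 0 < e ->
  exists N0, forall N, (N0 <= N)%N -> x ^+ N <= e.
Proof.
case/andP=> x0 x1 e0.
have [->|xn0] := eqVneq x 0.
  by exists 1%N => -[//|N] _; rewrite expr0n /= ltW.
have xp : 0 < x by rewrite lt_def xn0.
pose h := x^-1 - 1.
have h0 : 0 < h by rewrite subr_gt0 invf_gt1.
pose n := Num.bound (e^-1 / h).
have nP : e^-1 / h < n%:R.
  by apply: archi_boundP; rewrite divr_ge0 ?invr_ge0 // ltW.
exists n => N nN.
have xnp : 0 < x ^+ N by rewrite exprn_gt0.
rewrite -[e]invrK -[x ^+ N]invrK lef_pV2 ?posrE ?invr_gt0 // -exprVn.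
have -> : x^-1 = 1 + h by rewrite /h addrC subrK.
apply: le_trans (bernoulli_ge N (ltW h0)).
rewrite ltr_pdivrMr // in nP.
apply: le_trans (ltW nP) _; apply: (@le_trans _ _ (N%:R * h)).
  by rewrite ler_wpM2r ?ler_nat // ltW.
by rewrite lerDr.
Qed.

Definition vanishing u := forall e, 0 < e ->
  exists N0, forall N, (N0 <= N)%N -> nm (u N) <= e.

Lemma vanishing_ext u v : (exists N0, forall N, (N0 <= N)%N -> u N = v N) ->
  vanishing u -> vanishing v.
Proof.
move=> [N1 uv] uP e e0; have [N0 N0P] := uP _ e0.
by exists (maxn N0 N1) => N; rewrite geq_max => /andP[h1 h2]; rewrite -uv ?N0P.
Qed.

Lemma vanishingD u v : vanishing u -> vanishing v ->
  vanishing (fun N => u N + v N).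
Proof.
move=> uP vP e e0; have e2 : 0 < e / 2 by rewrite divr_gt0.
have [N0 N0P] := uP _ e2; have [N1 N1P] := vP _ e2.
exists (maxn N0 N1) => N; rewrite geq_max => /andP[h1 h2].
apply: le_trans (nmD _ _) _.
by have := N0P _ h1; have := N1P _ h2; lra.
Qed.

Lemma vanishingZ a u : vanishing u -> vanishing (fun N => a * u N).
Proof.
move=> uP e e0; have a1 : 0 < 1 + nm a by rewrite ltr_pwDl // nm_ge0.
have [N0 N0P] := uP _ (divr_gt0 e0 a1); exists N0 => N /N0P.
rewrite ler_pdivlMr // => h; rewrite nmM; apply: le_trans h.
by have := nm_ge0 (u N); nra.
Qed.

Lemma vanishingB u v : vanishing u -> vanishing v ->
  vanishing (fun N => u N - v N).
Proof.
move=> uP vP; apply: (@vanishing_ext (fun N => u N + (-1) * v N)).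
  by exists 0%N => N _; rewrite mulN1r.
exact: vanishingD uP (vanishingZ _ vP).
Qed.

Lemma vanishing0 : vanishing (fun=> 0).
Proof. by move=> e e0; exists 0%N => N _; rewrite nm0 ltW. Qed.

Lemma vanishing_sum (T : eqType) (s : seq T) (F : T -> nat -> C) :
  (forall t, t \in s -> vanishing (F t)) ->
  vanishing (fun N => \sum_(t <- s) F t N).
Proof.
elim: s => [|t s IH] h.
  apply: (@vanishing_ext (fun=> 0)); last exact: vanishing0.
  by exists 0%N => N _; rewrite big_nil.
apply: (@vanishing_ext (fun N => F t N + \sum_(t <- s) F t N)).
  by exists 0%N => N _; rewrite big_cons.
apply: vanishingD; first by apply: h; rewrite mem_head.
by apply: IH => t' t's; apply: h; rewrite in_cons t's orbT.
Qed.

Lemma nm_div1B z : nm z <= 2^-1 -> nm (z / (1 - z)) <= 2 * nm z.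
Proof.
move=> z2; have h : 2^-1 <= nm (1 - z).
  by apply: le_trans (nm_subl _ _); rewrite nm1; lra.
have h' : 0 < nm (1 - z) by apply: lt_le_trans h; rewrite invr_gt0.
rewrite nmM nmV ler_pdivrMr //.
by have := nm_ge0 z; nra.
Qed.

Lemma vanishing_pow z : nm z < 1 ->
  vanishing (fun N => z ^+ N / (1 - z ^+ N)).
Proof.
move=> z1 e e0; have := @expr_small (nm z) (Num.min (2^-1) (e / 2)).
rewrite nm_ge0 z1 lt_min => /(_ isT); rewrite invr_gt0 ltr0n divr_gt0 //.
move=> /(_ isT)[N0 N0P]; exists N0 => N /N0P; rewrite le_min -nmX.
by move=> /andP[h1 h2]; apply: le_trans (nm_div1B h1) _; lra.
Qed.

(** By [circ_avg_pole] the difference is v^N / (1 - v^N) with v = (a - c) / r of modulus less than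
    1. A pole outside is treated alike with v = r / (a - c). *)
Lemma vanishing_pole_inside c r a : 0 < r -> nm (a - c) < r ->
  vanishing (fun N => circ_avg N c r (fun z => (z - a)^-1) - 1).
Proof.
move=> r0 ar; have rn0 : (r%:C : C) != 0 by rewrite -nm_gt0 nm_real normr_gt0 gt_eqF.
have vP : nm ((a - c) / r%:C) < 1.
  by rewrite nmM nmV nm_real gtr0_norm // ltr_pdivrMr // mul1r.
apply: vanishing_ext (vanishing_pow vP).
exists 1%N => N N0; rewrite circ_avg_pole ?ltW ?lt_eqF //.
have den : r%:C ^+ N - (a - c) ^+ N != 0.
  rewrite subr_eq0; apply/eqP => /(congr1 (fun z : C => nm z)).
  rewrite !nmX nm_real gtr0_norm // => /eqP.
  by rewrite eqrXn2 ?nm_ge0 ?ltW // gt_eqF.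
rewrite expr_div_n; set x := r%:C ^+ N in den *.
have xn0 : x != 0 by rewrite expf_neq0.
by field; rewrite den xn0.
Qed.

Lemma vanishing_pole_outside c r a : 0 < r -> r < nm (a - c) ->
  vanishing (fun N => circ_avg N c r (fun z => (z - a)^-1)).
Proof.
move=> r0 ar; have un0 : a - c != 0 by rewrite -nm_gt0 (lt_trans r0).
have vP : nm (r%:C / (a - c)) < 1.
  by rewrite nmM nmV nm_real gtr0_norm // ltr_pdivrMr ?mul1r // (lt_trans r0).
apply: vanishing_ext (vanishingZ (-1) (vanishing_pow vP)).
exists 1%N => N N0; rewrite circ_avg_pole ?ltW ?gt_eqF //.
have den : r%:C ^+ N - (a - c) ^+ N != 0.
  rewrite subr_eq0; apply/eqP => /(congr1 (fun z : C => nm z)).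
  rewrite !nmX nm_real gtr0_norm // => /eqP.
  by rewrite eqrXn2 ?nm_ge0 ?ltW // lt_eqF.
rewrite expr_div_n; set x := r%:C ^+ N in den *; set y := (a - c) ^+ N in den *.
have yn0 : y != 0 by rewrite expf_neq0.
field; rewrite den yn0 /=.
by rewrite -opprB oppr_eq0.
Qed.

End Vanishing.

Lemma poly_bounded (R : realType) (p : R[i]) (P : {poly R[i]}) (r : R) :
  exists2 M, 0 < M & forall z, nm (z - p) <= r -> nm P.[z] <= M.
Proof.
pose B := `|r| + nm p.
exists (1 + \sum_(i < size P) nm P`_i * B ^+ i).
  rewrite ltr_pwDl // sumr_ge0 // => i _.
  by rewrite mulr_ge0 ?nm_ge0 // exprn_ge0 // addr_ge0 // nm_ge0.
move=> z zr; rewrite horner_coef; apply: le_trans (nm_sum _ _ _) _.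
rewrite -[leLHS]add0r; apply: lerD => //; apply: ler_sum => i _.
rewrite nmM nmX ler_wpM2l ?nm_ge0 // lerXn2r ?nnegrE ?nm_ge0 //.
  by rewrite addr_ge0 // nm_ge0.
by have := nm_dist z p 0; have := ler_norm r; rewrite !subr0 /B; lra.
Qed.

(** [D] splits into linear factors; each root lies off [O], hence at positive distance from it, so
    the factors are bounded below one by one. *)
Lemma poly_away_from_roots (R : realType) (O : set R[i]) (D : {poly R[i]}) :
  (forall a, ~ O a -> exists2 e : R, 0 < e & forall z, O z -> e <= nm (z - a)) ->
  (forall z, O z -> D.[z] != 0) ->
  exists2 e : R, 0 < e & forall z, O z -> e <= nm D.[z].
Proof.
move=> O_away DO; have [D0|D0] := eqVneq D 0.
  exists 1 => // z /DO; by rewrite D0 horner0 eqxx.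
have [s Ds] := closed_field_poly_normal D.
have lD : lead_coef D != 0 by rewrite lead_coef_eq0.
have sO a : a \in s -> ~ O a.
  move=> As /DO; apply/negP; rewrite negbK -rootE Ds rootZ // root_prod_XsubC //.
have [e e0 eP] : exists2 e : R, 0 < e &
    forall z, O z -> e <= nm (\prod_(a <- s) (z - a)).
  elim: s sO {Ds} => [|a s IH] sO.
    by exists 1 => // z _; rewrite big_nil nm1.
  have [e e0 eP] : exists2 e : R, 0 < e &
    forall z, O z -> e <= nm (\prod_(a <- s) (z - a)).
    by apply: IH => c cs; apply: sO; rewrite in_cons cs orbT.
  have [e' e'0 e'P] := O_away _ (sO a (mem_head _ _)).
  exists (e' * e); first exact: mulr_gt0.
  move=> z zO; rewrite big_cons nmM.
  by apply: ler_pM; [exact: ltW | exact: ltW | exact: e'P | exact: eP].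
exists (nm (lead_coef D) * e); first by rewrite mulr_gt0 // nm_gt0.
move=> z zO; rewrite {2}Ds hornerZ nmM horner_prod.
under eq_bigr do rewrite hornerXsubC.
by rewrite ler_pM2l ?nm_gt0 //; exact: eP.
Qed.

(** * Cauchy's theorem on an annulus with circular holes *)

Section Cauchy.
Variable R : realType.
Local Notation C := R[i].
Implicit Types (e r : R) (a c z : C) (G : C -> C) (b : C * R).
Variables (p : C) (t1 t2 : R) (bs : seq (C * R)).
Hypotheses (t2_gt0 : 0 < t2) (t21 : t2 < t1).
Hypothesis bs_annulus : forall b, b \in bs ->
  [/\ 0 < b.2, t2 < nm (b.1 - p) - b.2 & nm (b.1 - p) + b.2 < t1].
Hypothesis bs_uniq : uniq bs.
Hypothesis bs_disjoint : forall b b', b \in bs -> b' \in bs -> b != b' ->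
  b.2 + b'.2 < nm (b.1 - b'.1).

(** Discrete contour integral over the oriented boundary of [holed_annulus]. *)
Definition total_avg N G : C :=
  circ_avg N p t1 G - circ_avg N p t2 G - \sum_(b <- bs) circ_avg N b.1 b.2 G.

Definition holed_annulus : set C :=
  [set z | t2 <= nm (z - p) <= t1 /\ forall b, b \in bs -> b.2 <= nm (z - b.1)].

Lemma outer_in z : nm (z - p) = t1 -> holed_annulus z.
Proof.
move=> zt; split; first by rewrite zt lexx ltW.
move=> b /bs_annulus[b0 _ h].
by have := nm_dist z b.1 p; rewrite zt; lra.
Qed.

Lemma inner_in z : nm (z - p) = t2 -> holed_annulus z.
Proof.
move=> zt; split; first by rewrite zt lexx ltW.
move=> b /bs_annulus[b0 h _].
by have := nm_dist b.1 z p; rewrite zt (nmC b.1 z); lra.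
Qed.

Lemma disc_in z b : b \in bs -> nm (z - b.1) = b.2 -> holed_annulus z.
Proof.
move=> bbs zb; have [b0 h1 h2] := bs_annulus bbs; split.
  have := nm_dist z b.1 p; have := nm_dist b.1 z p.
  rewrite zb (nmC b.1 z) zb => *; apply/andP; split; lra.
move=> b' b'bs; have [<-|bb'] := eqVneq b b'; first by rewrite zb.
have := bs_disjoint bbs b'bs bb'; have := nm_dist b.1 z b'.1.
by rewrite (nmC b.1 z) zb; lra.
Qed.

Lemma circ_avg_ext N c r G1 G2 : 0 <= r -> (0 < N)%N ->
  (forall z, nm (z - c) = r -> G1 z = G2 z) ->
  circ_avg N c r G1 = circ_avg N c r G2.
Proof.
move=> r0 N0 h; rewrite /circ_avg; congr (_ * _); apply: eq_bigr => i _.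
by rewrite h // nm_node.
Qed.

Lemma total_avg_ext N G1 G2 : (0 < N)%N ->
  (forall z, holed_annulus z -> G1 z = G2 z) ->
  total_avg N G1 = total_avg N G2.
Proof.
move=> N0 h; have t1_gt0 := lt_trans t2_gt0 t21; congr (_ - _ - _).
- by apply: circ_avg_ext => // [|z /outer_in /h //]; rewrite ltW.
- by apply: circ_avg_ext => // [|z /inner_in /h //]; rewrite ltW.
- apply: eq_big_seq => b bbs; have [b0 _ _] := bs_annulus bbs.
  by apply: circ_avg_ext => // [|z /(disc_in bbs) /h //]; rewrite ltW.
Qed.

Lemma total_avgD N G1 G2 :
  total_avg N (fun z => G1 z + G2 z) = total_avg N G1 + total_avg N G2.
Proof.
rewrite /total_avg !circ_avgD; under eq_bigr do rewrite circ_avgD.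
by rewrite big_split /=; ring.
Qed.

Lemma total_avgZ N a G :
  total_avg N (fun z => a * G z) = a * total_avg N G.
Proof.
rewrite /total_avg !circ_avgZ; under eq_bigr do rewrite circ_avgZ.
by rewrite -mulr_sumr; ring.
Qed.

Lemma nm_total_avg N G M : (0 < N)%N ->
  (forall z, holed_annulus z -> nm (G z) <= M) ->
  nm (total_avg N G) <= (t1 + t2 + \sum_(b <- bs) b.2) * M.
Proof.
move=> N0 h; have t1_gt0 := lt_trans t2_gt0 t21.
have h1 : nm (circ_avg N p t1 G) <= t1 * M.
  by apply: nm_circ_avg => // [|z /outer_in /h //]; rewrite ltW.
have h2 : nm (circ_avg N p t2 G) <= t2 * M.
  by apply: nm_circ_avg => // [|z /inner_in /h //]; rewrite ltW.
have h3 : nm (\sum_(b <- bs) circ_avg N b.1 b.2 G) <= \sum_(b <- bs) b.2 * M.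
  apply: le_trans (nm_sum _ _ _) _; rewrite big_seq [leRHS]big_seq.
  apply: ler_sum => b bbs; have [b0 _ _] := bs_annulus bbs.
  by apply: nm_circ_avg => // [|z /(disc_in bbs) /h //]; rewrite ltW.
rewrite !mulrDl mulr_suml; apply: le_trans (nmB _ _) _; apply: lerD => //.
by apply: le_trans (nmB _ _) _; apply: lerD.
Qed.

Lemma vanishing_total_poly (P : {poly C}) :
  vanishing (fun N => total_avg N (fun z => P.[z])).
Proof.
apply: (vanishing_ext _ (@vanishing0 R)); exists (size P).+1 => N hN.
have t1_gt0 := lt_trans t2_gt0 t21.
rewrite /total_avg !circ_avg_poly ?ltW // big_seq big1 ?subr0 // => b bbs.
by have [b0 _ _] := bs_annulus bbs; rewrite circ_avg_poly // ltW.
Qed.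

(** The boundary has winding number 0 around [a]: in a hole, the outer circle cancels that of the
    hole; inside the inner circle, the outer and inner circles cancel; beyond the outer circle every
    term tends to 0. *)
Lemma vanishing_total_pole a : ~ holed_annulus a ->
  vanishing (fun N => total_avg N (fun z => (z - a)^-1)).
Proof.
move=> aO; have t1_gt0 := lt_trans t2_gt0 t21.
have [[b bbs ab]|nob] := pselect (exists2 b, b \in bs & nm (a - b.1) < b.2).
- have [b0 h1 h2] := bs_annulus bbs.
  have at1 : nm (a - p) < t1 by have := nm_dist a b.1 p; lra.
  have at2 : t2 < nm (a - p).
    by have := nm_dist b.1 a p; rewrite (nmC b.1 a); lra.
  apply: (@vanishing_ext _ (fun N =>
     (circ_avg N p t1 (fun z => (z - a)^-1) - 1)
     - circ_avg N p t2 (fun z => (z - a)^-1)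
     - (circ_avg N b.1 b.2 (fun z => (z - a)^-1) - 1)
     - \sum_(b' <- rem b bs) circ_avg N b'.1 b'.2 (fun z => (z - a)^-1))).
    exists 0%N => N _; rewrite /total_avg (big_rem b bbs) /=; ring.
  apply: vanishingB; first apply: vanishingB; first apply: vanishingB.
  + exact: vanishing_pole_inside.
  + exact: vanishing_pole_outside.
  + exact: vanishing_pole_inside.
  apply: vanishing_sum => b'; rewrite (mem_rem_uniq b bs_uniq) inE.
  move=> /andP[b'b b'bs]; have [b'0 _ _] := bs_annulus b'bs.
  apply: vanishing_pole_outside => //.
  have := bs_disjoint b'bs bbs b'b; have := nm_dist b'.1 a b.1.
  by rewrite (nmC b'.1 a); lra.
- have nobs b : b \in bs -> b.2 <= nm (a - b.1).
    by move=> bbs; rewrite leNgt; apply/negP => h; apply: nob; exists b.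
  have /negP : ~ (t2 <= nm (a - p) <= t1) by move=> h; exact: aO.
  rewrite negb_and -!ltNge => out.
  have bout b : b \in bs -> b.2 < nm (a - b.1).
    move=> bbs; have [b0 h1 h2] := bs_annulus bbs; case/orP: out => out.
      by have := nm_dist b.1 a p; rewrite (nmC b.1 a); lra.
    by have := nm_dist a b.1 p; lra.
  have sumv : vanishing (fun N =>
      \sum_(b <- bs) circ_avg N b.1 b.2 (fun z => (z - a)^-1)).
    apply: vanishing_sum => b bbs; have [b0 _ _] := bs_annulus bbs.
    by apply: vanishing_pole_outside => //; exact: bout.
  case/orP: out => out.
    apply: (@vanishing_ext _ (fun N =>
      (circ_avg N p t1 (fun z => (z - a)^-1) - 1)
      - (circ_avg N p t2 (fun z => (z - a)^-1) - 1)
      - \sum_(b <- bs) circ_avg N b.1 b.2 (fun z => (z - a)^-1))).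
      by exists 0%N => N _; rewrite /total_avg; ring.
    apply: vanishingB => //; apply: vanishingB; apply: vanishing_pole_inside => //.
    exact: lt_trans t21.
  apply: vanishingB => //; apply: vanishingB; apply: vanishing_pole_outside => //.
  exact: lt_trans out.
Qed.

(** Induction on the number of poles: 1 / ((z - a)(z - b)) is (a - b)^-1 times the difference of 1 /
    (z - a) and 1 / (z - b). A single pole is split off by dividing [P] by X - a. *)
Lemma vanishing_total_simple (s : seq C) (P : {poly C}) : uniq s ->
  (forall a, a \in s -> ~ holed_annulus a) ->
  vanishing (fun N => total_avg N (fun z => P.[z] / \prod_(a <- s) (z - a))).
Proof.
have [n] := ubnP (size s); elim: n s P => // n IH [|a [|b s]] P.
- move=> _ _ _; apply: vanishing_ext (vanishing_total_poly P).
  by exists 1%N => N N0; apply: total_avg_ext => // z _; rewrite big_nil divr1.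
- move=> _ _ sO; have aO : ~ holed_annulus a by apply: sO; rewrite mem_head.
  have [Q PQ] : exists Q : {poly C}, P = Q * ('X - a%:P) + P.[a]%:P.
    have /factor_theorem[Q PQ] : root (P - P.[a]%:P) a.
      by rewrite rootE !hornerE subrr.
    by exists Q; rewrite -PQ subrK.
  apply: (@vanishing_ext _ (fun N => total_avg N (fun z => Q.[z])
     + P.[a] * total_avg N (fun z => (z - a)^-1))).
    exists 1%N => N N0; rewrite -total_avgZ -total_avgD.
    apply: total_avg_ext => // z zO; rewrite big_seq1.
    have za : z - a != 0 by rewrite subr_eq0; apply/eqP => za; rewrite za in zO.
    by rewrite [in RHS]PQ !hornerE mulrDl mulfK.
  apply: vanishingD; first exact: vanishing_total_poly.
  by apply: vanishingZ; exact: vanishing_total_pole.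
- move=> sn us sO.
  have ab : a != b by move: us; rewrite /= in_cons negb_or -andbA => /and3P[].
  have sP t : t \in [:: a; b] -> forall z, holed_annulus z -> z - t != 0.
    move=> tab z zO; rewrite subr_eq0; apply/eqP => zt; rewrite zt in zO.
    by apply: (sO t) => //; move: tab; rewrite !inE => /orP[] ->; rewrite ?orbT.
  apply: (@vanishing_ext _ (fun N => (a - b)^-1 *
     (total_avg N (fun z => P.[z] / \prod_(c <- a :: s) (z - c))
     - total_avg N (fun z => P.[z] / \prod_(c <- b :: s) (z - c))))).
    exists 1%N => N N0; rewrite -[- total_avg _ _]mulN1r -total_avgZ -total_avgD.
    rewrite -total_avgZ; apply: total_avg_ext => // z zO.
    have za := sP a (mem_head _ _) z zO.
    have zb : z - b != 0 by apply: (sP b) => //; rewrite !inE eqxx orbT.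
    rewrite !big_cons !invfM; set w := (\prod_(c <- s) _)^-1.
    by field; rewrite za zb subr_eq0 ab.
  apply: vanishingZ; apply: vanishingB; apply: IH => //.
  + by move: us => /= /and3P[+ _ ->]; rewrite in_cons negb_or => /andP[_ ->].
  + move=> c; rewrite in_cons => h; apply: sO; rewrite !in_cons.
    by case/orP: h => ->; rewrite ?orbT.
  + by move: us => /= /and3P[_ -> ->].
  + by move=> c h; apply: sO; rewrite in_cons h orbT.
Qed.

Lemma away_from_root a : ~ holed_annulus a ->
  exists2 e, 0 < e & forall z, holed_annulus z -> e <= nm (z - a).
Proof.
move=> aO.
have [[b bbs ab]|nob] := pselect (exists2 b, b \in bs & nm (a - b.1) < b.2).
  exists (b.2 - nm (a - b.1)); first by rewrite subr_gt0.
  by move=> z [_ /(_ _ bbs)]; have := nm_dist z a b.1; lra.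
have nobs b : b \in bs -> b.2 <= nm (a - b.1).
  by move=> bbs; rewrite leNgt; apply/negP => h; apply: nob; exists b.
have /negP : ~ (t2 <= nm (a - p) <= t1) by move=> h; exact: aO.
rewrite negb_and -!ltNge => /orP[out|out].
  exists (t2 - nm (a - p)); first by rewrite subr_gt0.
  by move=> z [/andP[h _] _]; have := nm_dist z a p; lra.
exists (nm (a - p) - t1); first by rewrite subr_gt0.
by move=> z [/andP[_ h] _]; have := nm_dist a z p; rewrite (nmC a z); lra.
Qed.

(** [D + h] has a multiple root only if [- h] is a critical value of [D]. These are finitely many,
    so by counting one of the numbers e / (k + 2) avoids them. *)
Lemma separable_perturb (D : {poly C}) e : 0 < e -> D != 0 ->
  exists2 h : C, nm h < e & separable_poly (D + h%:P).
Proof.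
move=> e0 D0; have [szD|szD] := leqP (size D) 1.
  exists 0; first by rewrite nm0.
  rewrite polyC0 addr0 unlock; apply: Pdiv.ClosedField.root_coprimep => x.
  by rewrite (size1_polyC szD) rootC => /eqP d0; move: D0; rewrite (size1_polyC szD) d0 polyC0 eqxx.
have D'0 : D^`() != 0.
  apply/eqP => /(congr1 (fun q : {poly C} => q`_(size D).-2)); rewrite coef0 coef_deriv.
  have -> : (size D).-2.+1 = (size D).-1 by lia.
  by move/eqP; rewrite -lead_coefE mulrn_eq0 lead_coef_eq0 (negbTE D0) orbF; lia.
have [rs D's] := closed_field_poly_normal D^`().
have lD' : lead_coef D^`() != 0 by rewrite lead_coef_eq0.
pose hh (k : nat) : C := (e / k.+2%:R)%:C.
have hh_inj : injective hh.
  move=> k l /complexI /(mulfI (lt0r_neq0 e0)) /invr_inj /eqP.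
  by rewrite eqr_nat => /eqP [].
have [k _ kP] : exists2 k, k \in iota 0 (size rs).+1 &
    hh k \notin [seq - D.[z] | z <- rs].
  apply/hasP; rewrite -[has _ _]negbK -all_predC; apply/negP => /allP /= allin.
  have : (size [seq hh k | k <- iota 0 (size rs).+1] <= size [seq - D.[z] | z <- rs])%N.
    apply: uniq_leq_size; first by rewrite map_inj_uniq ?iota_uniq.
    by move=> _ /mapP[k /allin + ->]; rewrite negbK.
  by rewrite !size_map size_iota ltnn.
exists (hh k).
  rewrite nm_real ger0_norm ?divr_ge0 ?ltW // ltr_pdivrMr // ltr_pMr //.
  by rewrite ltr1n.
rewrite unlock; apply: Pdiv.ClosedField.root_coprimep => x rx.
apply: contra kP; rewrite derivD derivC addr0 => /eqP x0; apply/mapP; exists x.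
  by rewrite -root_prod_XsubC -(rootZ _ _ lD') -D's rootE x0.
by move: rx; rewrite rootE !hornerE addrC addr_eq0 => /eqP.
Qed.

(** A small constant added to the denominator makes its roots simple and reduces to
    [vanishing_total_simple]; the error is bounded uniformly in the number of nodes. *)
Lemma vanishing_total_rational (P D : {poly C}) :
  (forall z, holed_annulus z -> D.[z] != 0) ->
  vanishing (fun N => total_avg N (fun z => P.[z] / D.[z])).
Proof.
move=> DO e e0; have t1_gt0 := lt_trans t2_gt0 t21.
have D0 : D != 0.
  have : holed_annulus (p + t1%:C).
    by apply: outer_in; rewrite addrC addKr nm_real gtr0_norm.
  by move=> /DO; apply: contraNneq => ->; rewrite horner0.
have [d d0 dP] := poly_away_from_roots away_from_root DO.
have [M M0 MP] := poly_bounded p P t1.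
pose S := t1 + t2 + \sum_(b <- bs) b.2.
have S0 : 0 < S.
  rewrite ltr_pwDl ?addr_gt0 // big_seq sumr_ge0 // => b /bs_annulus[b0 _ _].
  exact: ltW.
(* The first bound keeps the perturbed denominator above [d / 2]; the second makes the two quotients
   differ by at most [e / 2 / S], where [S] is the sum of all radii. *)
pose e' := Num.min (d / 2) (e / 2 / S * (d * (d / 2)) / M).
have e'0 : 0 < e' by rewrite lt_min !mulr_gt0 ?invr_gt0 ?mulr_gt0 ?invr_gt0.
have [h he sepD] := separable_perturb e'0 D0.
move: he; rewrite lt_min => /andP[he1 he2].
have DhO z : holed_annulus z -> d / 2 <= nm (D + h%:P).[z].
  move=> zO; rewrite !hornerE; have := dP _ zO.
  by have := nm_subl D.[z] (- h); rewrite nmN opprK; lra.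
have [s Ds] := closed_field_poly_normal (D + h%:P).
have Dh0 : D + h%:P != 0.
  have : holed_annulus (p + t1%:C).
    by apply: outer_in; rewrite addrC addKr nm_real gtr0_norm.
  move=> /DhO; rewrite leNgt; apply: contraNneq => ->.
  by rewrite horner0 nm0 divr_gt0.
have lDh : lead_coef (D + h%:P) != 0 by rewrite lead_coef_eq0.
have us : uniq s.
  rewrite -separable_prod_XsubC; apply: dvdp_separable sepD.
  by rewrite Ds dvdpZr.
have sO a : a \in s -> ~ holed_annulus a.
  move=> As /DhO; rewrite leNgt; apply/negP; rewrite negbK.
  have /rootP -> : root (D + h%:P) a by rewrite Ds rootZ // root_prod_XsubC.
  by rewrite nm0 divr_gt0.
have [N0 N0P] := vanishingZ (lead_coef (D + h%:P))^-1 (vanishing_total_simple P us sO)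
  (divr_gt0 e0 (ltr0n _ 2)).
exists (maxn N0 1) => N; rewrite geq_max => /andP[/N0P hN N1].
pose G z := P.[z] / D.[z] - P.[z] / (D + h%:P).[z].
have GO z : holed_annulus z -> nm (G z) <= e / 2 / S.
  move=> zO; have [/andP[_ zt1] _] := zO.
  have Dz := DO _ zO; have nDz := dP _ zO; have nDhz := DhO _ zO.
  have Dhz : (D + h%:P).[z] != 0 by rewrite -nm_gt0 (lt_le_trans _ nDhz) // divr_gt0.
  have -> : G z = P.[z] * h / (D.[z] * (D + h%:P).[z]).
    by rewrite /G; move: Dhz; rewrite !hornerE => Dhz; field; rewrite Dz Dhz.
  rewrite nmM nmV !nmM ler_pdivrMr; last by rewrite mulr_gt0 ?nm_gt0.
  apply: (@le_trans _ _ (e / 2 / S * (d * (d / 2)))).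
    rewrite ltr_pdivlMr // in he2; apply: le_trans (ltW he2); rewrite mulrC.
    by rewrite ler_wpM2l ?nm_ge0 // MP.
  apply: ler_wpM2l; first by rewrite !divr_ge0 // ltW.
  by apply: ler_pM => //; rewrite ?divr_ge0 // ltW.
have -> : total_avg N (fun z => P.[z] / D.[z]) = total_avg N G +
   (lead_coef (D + h%:P))^-1 * total_avg N (fun z => P.[z] / \prod_(a <- s) (z - a)).
  rewrite -total_avgZ -total_avgD; apply: total_avg_ext => // z zO.
  have Dhz : (D + h%:P).[z] = lead_coef (D + h%:P) * \prod_(a <- s) (z - a).
    rewrite {1}Ds hornerZ horner_prod; congr (_ * _).
    by apply: eq_bigr => a _; rewrite hornerXsubC.
  by rewrite /G Dhz invfM [X in _ - X]mulrCA subrK.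
apply: le_trans (nmD _ _) _.
have := nm_total_avg N1 GO; rewrite -/S mulrCA divff ?gt_eqF // mulr1 => h1.
by move: hN; lra.
Qed.

End Cauchy.

(** * Merging overlapping discs *)

Section Merging.
Variable R : realType.
Local Notation C := R[i].
Local Notation disc := (C * R)%type.
Implicit Types (d : disc) (B : seq disc) (x y : seq disc * C).

Definition total_radius B : R := \sum_(d <- B) d.2.

(** A block is a list of discs with a centre. Its enclosing disc gets the sum of the radii as
    radius, so merging blocks preserves the total radius. *)
Definition encloses x : bool :=
  all (fun d => nm (d.1 - x.2) + d.2 <= total_radius x.1) x.1.

Definition separated x y : bool :=
  total_radius x.1 + total_radius y.1 < nm (x.2 - y.2).

Lemma separated_sym x y : separated x y = separated y x.
Proof. by rewrite /separated addrC nmC. Qed.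

(* Two overlapping discs of radii [r1], [r2] lie in the disc of radius
   [r1 + r2] centred at the barycentre of their centres. *)
Lemma merge_two x y : encloses x -> encloses y ->
  0 < total_radius x.1 -> 0 < total_radius y.1 -> ~~ separated x y ->
  exists c, encloses (x.1 ++ y.1, c).
Proof.
case: x y => [B c] [B' c']; rewrite /encloses /separated /= => hB hB' r0 r'0.
rewrite -leNgt => cc'.
set r := total_radius B in hB r0 cc' *; set r' := total_radius B' in hB' r'0 cc' *.
have rE : total_radius (B ++ B') = r + r' by rewrite /total_radius big_cat.
have rr0 : 0 < r + r' by exact: addr_gt0.
pose t := r' / (r + r').
pose c0 := c + t%:C * (c' - c).
have t0 : 0 <= t by apply: divr_ge0; exact: ltW.
have t'0 : 0 <= r / (r + r') by apply: divr_ge0; exact: ltW.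
have cc0 : nm (c - c0) <= r'.
  rewrite nmC /c0 addrC addKr nmM nm_real ger0_norm //.
  by rewrite nmC /t mulrAC ler_pdivrMr // ler_wpM2l // ltW.
have c'c0 : nm (c' - c0) <= r.
  have -> : c' - c0 = (r / (r + r'))%:C * (c' - c).
    have -> : r / (r + r') = 1 - t by rewrite /t; field; rewrite gt_eqF.
    by rewrite rmorphB rmorph1 /c0; ring.
  rewrite nmM nm_real ger0_norm //.
  by rewrite nmC mulrAC ler_pdivrMr // ler_wpM2l // ltW.
exists c0; rewrite all_cat rE; apply/andP; split; apply/allP => d dB.
  by have := allP hB _ dB; have := nm_dist d.1 c c0; lra.
by have := allP hB' _ dB; have := nm_dist d.1 c' c0; lra.
Qed.

(** If [x] meets some block, the two are merged and the result, which may meet further blocks, is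
    inserted again among the fewer remaining ones. *)
Lemma merge_insert x (ps : seq (seq disc * C)) :
  encloses x -> 0 < total_radius x.1 ->
  {in ps, forall y, encloses y /\ 0 < total_radius y.1} ->
  pairwise separated ps ->
  exists ps', [/\ perm_eq (flatten (unzip1 ps')) (x.1 ++ flatten (unzip1 ps)),
    {in ps', forall y, encloses y /\ 0 < total_radius y.1} &
    pairwise separated ps'].
Proof.
have [n] := ubnP (size ps); elim: n x ps => // n IH x ps psn xe x0 pse pss.
have [xs|] := boolP (all (separated x) ps).
  exists (x :: ps); split; [exact: perm_refl| |by rewrite pairwise_cons xs].
  by move=> y; rewrite in_cons => /orP[/eqP -> //|/pse].
rewrite -has_predC => /hasP[y yps /= xy].
have [ye y0] := pse _ yps.
have [c ce] := merge_two xe ye x0 y0 xy.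
have rE : total_radius (x.1 ++ y.1) = total_radius x.1 + total_radius y.1.
  by rewrite /total_radius big_cat.
have [] := IH (x.1 ++ y.1, c) (rem y ps) _ ce.
- by rewrite size_rem //; move: psn yps; case: (ps).
- by rewrite rE addr_gt0.
- by move=> z /mem_rem /pse.
- exact: subseq_pairwise (rem_subseq _ _) pss.
move=> ps' [ps'p ps'e ps's]; exists ps'; split => //.
apply: perm_trans ps'p _; rewrite /= -catA perm_cat2l.
have /(perm_map fst) /perm_flatten := perm_to_rem yps.
by rewrite perm_sym.
Qed.

Lemma merge_discs (s : seq disc) : {in s, forall d, 0 < d.2} ->
  exists ps, [/\ perm_eq (flatten (unzip1 ps)) s,
    {in ps, forall y, encloses y /\ 0 < total_radius y.1} &
    pairwise separated ps].
Proof.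
elim: s => [|d s IH] s0; first by exists [::]; split.
have [|ps [psp pse pss]] := IH.
  by move=> d' d's; apply: s0; rewrite in_cons d's orbT.
have rE : total_radius [:: d] = d.2 by rewrite /total_radius big_seq1.
have de : encloses ([:: d], d.1).
  by rewrite /encloses /= rE subrr nm0 add0r lexx.
have [] := merge_insert de _ pse pss; first by rewrite rE s0 // mem_head.
move=> ps' [ps'p ps'e ps's]; exists ps'; split => //.
by apply: perm_trans ps'p _; rewrite /= perm_cons.
Qed.

Lemma avoid_intervals (s : seq (R * R)) (a b : R) :
  {in s, forall i, i.1 <= i.2} -> \sum_(i <- s) (i.2 - i.1) < b - a ->
  exists2 t, a <= t <= b & {in s, forall i, ~~ (i.1 <= t <= i.2)}.
Proof.
have [n] := ubnP (size s); elim: n s a => // n IH s a sn s0 sab.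
have sum0 (s' : seq (R * R)) : {subset s' <= s} ->
    0 <= \sum_(i <- s') (i.2 - i.1).
  by move=> ss; rewrite big_seq sumr_ge0 // => i /ss /s0; rewrite subr_ge0.
have [/allP as_|] := boolP (all (fun i => ~~ (i.1 <= a <= i.2)) s).
  by exists a => //; rewrite lexx /=; have := sum0 _ (fun=> id); lra.
rewrite -has_predC => /hasP[i is_ /=]; rewrite negbK => /andP[ia ai].
move: (sab); rewrite (big_rem i is_) /=.
set S := \sum_(j <- rem i s) _ => sabS.
(* Half of the slack: the left end moves just past the interval [i] containing it, and the remaining
   intervals still do not fill what is left. *)
pose g := (b - a - (i.2 - i.1 + S)) / 2.
have g0 : 0 < g by rewrite divr_gt0 // subr_gt0.
have [] := IH (rem i s) (i.2 + g).
- by rewrite size_rem //; move: sn is_; case: (s).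
- by move=> j /mem_rem /s0.
- by rewrite -/S /g; lra.
move=> t /andP[t1 t2] ts; exists t; first by apply/andP; split; lra.
move=> j js; have [->|ji] := eqVneq j i; first by rewrite negb_and -!ltNge; apply/orP; right; lra.
by apply: ts; move: js; rewrite (perm_mem (perm_to_rem is_)) in_cons (negbTE ji).
Qed.

End Merging.

(** * The obstruction at a centre *)

Section LowerBound.
Variable R : realType.
Local Notation C := R[i].
Local Notation disc := (C * R)%type.
Variables (p : C) (n : nat) (s : seq disc).
Hypothesis s_pos : {in s, forall d, 0 < d.2}.
Hypothesis s_near : {in s, forall d, 0 < nm (d.1 - p) <= 1}.
Hypothesis s_sum : \sum_(d <- s) d.2 / nm (d.1 - p) ^+ n.+1 <= 16^-1.

(** The weights d.2 / |d.1 - p|^(n+1) in a block sum to at most 1/16, which forces the radius of the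
    block below 1/16 of its distance to [p] plus its radius. Enclosing discs are thus small compared
    with their distance to [p], and merging costs at most a factor 2^(n+1) in the weighted sum. *)
Lemma merged_discs : exists ps : seq (seq disc * C),
  [/\ {in ps, forall x, 0 < total_radius x.1 <= nm (x.2 - p) / 15},
      pairwise (@separated R) ps,
      forall z : C, {in ps, forall x, total_radius x.1 <= nm (z - x.2)} ->
        {in s, forall d, d.2 <= nm (z - d.1)} &
      \sum_(x <- ps) total_radius x.1 / (nm (x.2 - p) - total_radius x.1) ^+ n.+1
        <= 2 ^+ n.+1 / 16 /\
      \sum_(x <- ps) total_radius x.1 / (nm (x.2 - p) + total_radius x.1) <= 16^-1].
Proof.
have [ps [psp pse pss]] := merge_discs s_pos.
have ins x d : x \in ps -> d \in x.1 -> d \in s.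
  move=> xps dx; rewrite -(perm_mem psp); apply/flattenP; exists x.1 => //.
  exact: map_f.
have s_ge0 d : d \in s -> 0 <= d.2 by move=> ds; apply: ltW; exact: s_pos.
have r_gt0 x : x \in ps -> 0 < total_radius x.1 by move=> xps; have [] := pse _ xps.
have [w wE] : exists w : disc -> R, w = fun d => d.2 / nm (d.1 - p) ^+ n.+1 by eexists.
have s_sum' : \sum_(d <- s) w d <= 16^-1 by rewrite wE.
have w0 d : d \in s -> 0 <= w d.
  by move=> ds; rewrite wE divr_ge0 ?s_ge0 // exprn_ge0 // nm_ge0.
have sumE : \sum_(x <- ps) \sum_(d <- x.1) w d = \sum_(d <- s) w d.
  rewrite -(perm_big _ psp) /= big_flatten /= /unzip1 big_map.
  by [].
have block x : x \in ps -> \sum_(d <- x.1) w d <= 16^-1.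
  move=> xps; apply: le_trans s_sum'; rewrite -sumE (big_rem x xps) /=.
  rewrite lerDl big_seq sumr_ge0 // => y /mem_rem yps.
  by rewrite big_seq sumr_ge0 // => d /(ins _ _ yps) /w0.
have dist x d : x \in ps -> d \in x.1 ->
    nm (d.1 - p) <= nm (x.2 - p) + total_radius x.1.
  move=> xps dx; have [/allP /(_ _ dx) h _] := pse _ xps.
  have := s_pos (ins _ _ xps dx); have := nm_dist d.1 x.2 p; lra.
(* As [nm (d.1 - p) <= 1], the exponent [n.+1] can be lowered to 1. *)
have w_ge d : d \in s -> d.2 <= w d * nm (d.1 - p).
  move=> ds; have /andP[h0 h1] := s_near ds; rewrite wE exprSr.
  have hn : 0 < nm (d.1 - p) ^+ n by rewrite exprn_gt0.
  rewrite invfM mulrA divfK ?gt_eqF //.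
  rewrite ler_peMr ?s_ge0 // -(mul1r (_^-1)) ler_pdivlMr // mul1r.
  by rewrite exprn_ile1 // nm_ge0.
have small x : x \in ps -> total_radius x.1 <= nm (x.2 - p) / 15.
  move=> xps; have [_ r0] := pse _ xps.
  have : total_radius x.1 <= 16^-1 * (nm (x.2 - p) + total_radius x.1).
    apply: (@le_trans _ _ (\sum_(d <- x.1) w d * (nm (x.2 - p) + total_radius x.1))).
      rewrite {1}/total_radius big_seq [leRHS]big_seq; apply: ler_sum => d dx.
      apply: le_trans (w_ge _ (ins _ _ xps dx)) _.
      by apply: ler_wpM2l; [exact: w0 _ (ins _ _ xps dx) | exact: dist].
    by rewrite -mulr_suml ler_wpM2r ?block // addr_ge0 ?nm_ge0 // ltW.
  lra.
exists ps; split => //.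
- by move=> x xps; rewrite small // andbT; have [] := pse _ xps.
- move=> z zps d; rewrite -(perm_mem psp) => /flattenP[B /mapP[x xps ->] dx].
  have [/allP /(_ _ dx) h _] := pse _ xps; have := zps _ xps.
  by have := nm_dist z d.1 x.2; lra.
- have wx0 x d : x \in ps -> d \in x.1 -> 0 <= w d by move=> xps /(ins _ _ xps) /w0.
  split.
    apply: (@le_trans _ _ (2 ^+ n.+1 * \sum_(x <- ps) \sum_(d <- x.1) w d)); last first.
      by rewrite sumE ler_wpM2l ?exprn_ge0.
    rewrite mulr_sumr big_seq [leRHS]big_seq; apply: ler_sum => x xps.
    rewrite {1}/total_radius mulr_sumr mulr_suml big_seq [leRHS]big_seq.
    apply: ler_sum => d dx; have ds := ins _ _ xps dx.
    have /andP[h0 h1] := s_near ds; have h2 := dist _ _ xps dx.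
    have h3 := small _ xps; have h4 := r_gt0 _ xps.
    rewrite wE mulrCA; apply: ler_wpM2l; first exact: s_ge0.
    rewrite -!exprVn -exprMn; apply: lerXn2r; rewrite ?nnegrE.
    - by rewrite invr_ge0; lra.
    - by rewrite divr_ge0 // ltW.
    rewrite ler_pdivlMr // mulrC ler_pdivrMr; lra.
  apply: le_trans s_sum'; rewrite -sumE big_seq [leRHS]big_seq.
  apply: ler_sum => x xps; have h4 := r_gt0 _ xps; have := nm_ge0 (x.2 - p) => h5.
  rewrite ler_pdivrMr ?ltr_wpDl // {1}/total_radius mulr_suml big_seq [leRHS]big_seq.
  apply: ler_sum => d dx; have ds := ins _ _ xps dx.
  apply: le_trans (w_ge _ ds) _; apply: ler_wpM2l; first exact: w0.
  exact: dist.
Qed.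

Lemma invX_le (t r : R) k : 0 < r -> r / 2 <= t -> (t ^+ k)^-1 <= (2 / r) ^+ k.
Proof.
move=> r0 rt; rewrite -exprVn; have t0 : 0 < t by lra.
apply: lerXn2r; rewrite ?nnegrE ?invr_ge0 ?divr_ge0 ?(ltW r0) ?(ltW t0) //.
by rewrite -[_ / r]invf_div lef_pV2 ?posrE ?divr_gt0.
Qed.

(** A disc whose nearest distance to [p] is at most [t] has its farthest distance below 2 t, since
    its radius is relatively small. The radial shadows of these discs then have total length at most
    4 t / 16, less than the length t / 2 available. *)
Lemma avoid_discs (ps : seq (seq disc * C)) (t : R) : 0 < t ->
  {in ps, forall x, 0 < total_radius x.1 <= nm (x.2 - p) / 15} ->
  \sum_(x <- ps) total_radius x.1 / (nm (x.2 - p) + total_radius x.1) <= 16^-1 ->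
  exists2 t', t / 2 <= t' <= t &
    {in ps, forall x, t' < nm (x.2 - p) - total_radius x.1 \/
                      nm (x.2 - p) + total_radius x.1 < t'}.
Proof.
move=> t0 psP ps_sum.
pose f (x : seq disc * C) := (nm (x.2 - p) - total_radius x.1, nm (x.2 - p) + total_radius x.1).
have [] := @avoid_intervals R [seq f x | x <- ps & nm (x.2 - p) - total_radius x.1 <= t] (t / 2) t.
- move=> i /mapP[x]; rewrite mem_filter => /andP[_ /psP /andP[h _]] -> /=; lra.
- rewrite big_map big_filter /=.
  apply: (@le_lt_trans _ _ (\sum_(x <- ps) (4 * t) *
      (total_radius x.1 / (nm (x.2 - p) + total_radius x.1)))).
    rewrite [leRHS](bigID (fun x => nm (x.2 - p) - total_radius x.1 <= t)) /=.
    rewrite -[leLHS]addr0; apply: lerD; last first.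
      rewrite big_seq_cond sumr_ge0 // => x /andP[/psP /andP[h _] _].
      have := nm_ge0 (x.2 - p) => h'.
      by rewrite !mulr_ge0 ?invr_ge0 ?addr_ge0 // ltW.
    rewrite big_seq_cond [leRHS]big_seq_cond; apply: ler_sum => x /andP[/psP /andP[h h'] h''].
    by rewrite mulrA ler_pdivlMr; nra.
  by rewrite -mulr_sumr; nra.
move=> t' t't avoid; exists t' => // x xps.
have [xt|xt] := leP (nm (x.2 - p) - total_radius x.1) t.
  have := avoid (f x); rewrite map_f ?mem_filter ?xt // => /(_ isT) /=.
  by rewrite negb_and -!ltNge => /orP[]; [left|right].
by left; case/andP: t't; lra.
Qed.

(** Cauchy's theorem for (P / q - (z - p)^n) / (z - p)^(n+1) between circles of radii near [rho] and
    [delta] that miss the merged discs. The outer circle and the holes account for the factor of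
    [e], the inner circle for the factor of [e'] and for the 1. *)
Lemma lower_bound (P q : {poly C}) (rho delta e e' : R) :
  0 < delta -> delta < rho / 2 -> 0 <= e -> 0 <= e' ->
  (forall z, nm (z - p) <= rho -> {in s, forall d, d.2 <= nm (z - d.1)} ->
     q.[z] != 0 /\ nm (P.[z] / q.[z] - (z - p) ^+ n) <= e) ->
  (forall z, nm (z - p) <= delta -> {in s, forall d, d.2 <= nm (z - d.1)} ->
     nm (P.[z] / q.[z]) <= e') ->
  1 <= e * ((2 / rho) ^+ n + 2 ^+ n.+1 / 16) + e' * (2 / delta) ^+ n.
Proof.
move=> delta0 delta_rho e0 e'0 near_pow near_0.
have [ps [psP pss cover [sum1 sum2]]] := merged_discs.
have rho0 : 0 < rho by lra.
have [t1 /andP[t1l t1u] avoid1] := avoid_discs rho0 psP sum2.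
have [t2 /andP[t2l t2u] avoid2] := avoid_discs delta0 psP sum2.
have t2_gt0 : 0 < t2 by lra.
have t21 : t2 < t1 by lra.
have t1_gt0 : 0 < t1 by lra.
(* By the choice of [t1] and [t2] each merged disc is inside the inner circle, outside the outer
   one, or between them; only the last kind are holes of the annulus. *)
pose between (x : seq disc * C) :=
  (t2 < nm (x.2 - p) - total_radius x.1) && (nm (x.2 - p) + total_radius x.1 < t1).
pose f (x : seq disc * C) := (x.2, total_radius x.1).
pose bs := [seq f x | x <- ps & between x].
have bsP b : b \in bs -> exists x, [/\ x \in ps, between x & b = f x].
  by move=> /mapP[x]; rewrite mem_filter => /andP[h1 h2] ->; exists x.
have psf x y : x \in ps -> y \in ps -> f x != f y -> separated x y.
  move=> xps yps xy; have xy' : x != y by apply: contra_neq xy => ->.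
  wlog ij : x y xps yps xy xy' / (index x ps < index y ps)%N.
    move=> h; have [|ij|ij] := ltngtP (index x ps) (index y ps); first exact: h.
      by rewrite separated_sym; apply: h; rewrite // eq_sym.
    by move: xy'; rewrite -(nth_index x xps) ij nth_index // eqxx.
  have /(pairwiseP x) := pss => /(_ (index x ps) (index y ps)).
  by rewrite !inE !index_mem xps yps !nth_index // => /(_ isT isT ij).
have bs_annulus b : b \in bs ->
    [/\ 0 < b.2, t2 < nm (b.1 - p) - b.2 & nm (b.1 - p) + b.2 < t1].
  by move=> /bsP[x [/psP /andP[x0 _] /andP[x1 x2] ->]].
have bs_uniq : uniq bs.
  rewrite uniq_pairwise pairwise_map.
  apply: (@sub_in_pairwise _ (mem ps) (@separated R)).
  - move=> x y /psP /andP[x0 _] _; rewrite /separated.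
    by apply: contraTneq => -[-> <-]; rewrite subrr nm0 -leNgt; lra.
  - by apply/allP => x; rewrite mem_filter => /andP[].
  exact: subseq_pairwise (filter_subseq _ _) pss.
have bs_disjoint b b' : b \in bs -> b' \in bs -> b != b' ->
    b.2 + b'.2 < nm (b.1 - b'.1).
  by move=> /bsP[x [xps _ ->]] /bsP[y [yps _ ->]] xy; exact: psf.
have in_cover z : holed_annulus p t1 t2 bs z ->
    {in s, forall d, d.2 <= nm (z - d.1)}.
  move=> [/andP[z1 z2] zbs]; apply: cover => x xps.
  have [xb|] := boolP (between x).
    by apply: (zbs (f x)); apply: map_f; rewrite mem_filter xb.
  have h1 := nm_dist z x.2 p; have h2 := nm_dist x.2 z p.
  rewrite (nmC x.2 z) in h2.
  rewrite negb_and -!leNgt => /orP[xb|xb].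
    by case: (avoid2 _ xps) => h; lra.
  by case: (avoid1 _ xps) => h; lra.
pose G z := (P - q * ('X - p%:P) ^+ n).[z] / (q * ('X - p%:P) ^+ n.+1).[z].
have GE z : q.[z] != 0 -> z - p != 0 -> G z = (P.[z] / q.[z] - (z - p) ^+ n) / (z - p) ^+ n.+1.
  move=> qz zp; rewrite /G !hornerE /=.
  have h : (z - p) ^+ n != 0 by rewrite expf_neq0.
  by rewrite exprS; field; rewrite qz zp h.
have zp0 z : t2 <= nm (z - p) -> z - p != 0.
  by move=> h; rewrite -nm_gt0; exact: lt_le_trans h.
have Gv : vanishing (fun N => total_avg p t1 t2 bs N G).
  apply: vanishing_total_rational => // z zO.
  have [/andP[z1 z2] _] := zO.
  rewrite !hornerE /= mulf_neq0 ?expf_neq0 ?zp0 //.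
  by have [] := near_pow z _ (in_cover _ zO); first lra.
have Gbound z M : holed_annulus p t1 t2 bs z -> 0 < M ->
    M <= nm (z - p) -> nm (G z) <= e / M ^+ n.+1.
  move=> zO M0 Mz; have [/andP[z1 z2] _] := zO.
  have [|qz h] := near_pow z _ (in_cover _ zO); first lra.
  rewrite GE ?zp0 // nmM nmV nmX; apply: ler_pM; rewrite ?invr_ge0 ?exprn_ge0 ?nm_ge0 //.
  rewrite lef_pV2 ?posrE ?exprn_gt0 //; last exact: lt_le_trans Mz.
  by rewrite lerXn2r ?nnegrE ?nm_ge0 // ltW.
apply/ler_addgt0Pr => eps eps0.
have [N0 N0P] := Gv _ eps0.
pose N := N0.+1.
have tot : nm (total_avg p t1 t2 bs N G) <= eps by apply: N0P; rewrite /N.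
have inner1 : circ_avg N p t2 (fun z => (z - p)^-1) = 1.
  have pt2 : nm (p - p) != t2 by rewrite subrr nm0 lt_eqF.
  rewrite (circ_avg_pole (ltW t2_gt0) (ltn0Sn N0) pt2) subrr expr0n subr0 divff //.
  by rewrite expf_neq0 // -nm_gt0 nm_real normr_gt0 gt_eqF.
have outer : nm (circ_avg N p t1 G) <= e * (2 / rho) ^+ n.
  apply: (@le_trans _ _ (t1 * (e / t1 ^+ n.+1))).
    apply: nm_circ_avg => // [|z zt1]; first exact: ltW.
    by apply: Gbound => //; [exact: outer_in | rewrite zt1].
  rewrite exprS invfM mulrCA mulVKf ?gt_eqF // ler_wpM2l // invX_le //.
have discs : nm (\sum_(b <- bs) circ_avg N b.1 b.2 G) <= e * (2 ^+ n.+1 / 16).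
  apply: (@le_trans _ _ (\sum_(b <- bs) e * (b.2 / (nm (b.1 - p) - b.2) ^+ n.+1))).
    apply: le_trans (nm_sum _ _ _) _; rewrite big_seq [leRHS]big_seq.
    apply: ler_sum => b bbs; have [b0 b1 b2] := bs_annulus _ bbs.
    rewrite mulrCA; apply: nm_circ_avg => // [|z zb]; first exact: ltW.
    apply: Gbound; [by apply: disc_in bbs zb|by lra|].
    by have := nm_dist b.1 z p; rewrite (nmC b.1 z) zb; lra.
  rewrite -mulr_sumr ler_wpM2l //; apply: le_trans sum1.
  rewrite big_map big_filter [leRHS](bigID between) /= lerDl.
  rewrite big_seq_cond sumr_ge0 // => x /andP[/psP /andP[x0 x1] _].
  rewrite divr_ge0 ?exprn_ge0 // ?ltW //; lra.
(* The summand -(z - p)^n / (z - p)^(n+1) of [G] averages to -1, while [P / q] is small on the inner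
   circle. *)
have inner : 1 <= nm (circ_avg N p t2 G) + e' * (2 / delta) ^+ n.
  have GE' : circ_avg N p t2 G = circ_avg N p t2 (fun z => P.[z] / q.[z] / (z - p) ^+ n.+1)
      - 1.
    rewrite -inner1 -mulN1r -circ_avgZ -circ_avgD.
    apply: circ_avg_ext => // [|z zt]; first exact: ltW.
    have zO := inner_in t21 bs_annulus zt.
    have [|qz h] := near_pow z _ (in_cover _ zO); first lra.
    have zp : z - p != 0 by rewrite zp0 // zt.
    rewrite GE // mulrBl; congr (_ + _).
    by rewrite exprSr invfM mulrA divff ?expf_neq0 // mul1r mulN1r.
  have h : nm (circ_avg N p t2 (fun z => P.[z] / q.[z] / (z - p) ^+ n.+1)) <= e' * (2 / delta) ^+ n.
    apply: (@le_trans _ _ (t2 * (e' / t2 ^+ n.+1))).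
      apply: nm_circ_avg => // [|z zt]; first exact: ltW.
      have zO := inner_in t21 bs_annulus zt.
      rewrite nmM nmV nmX zt ler_wpM2r ?invr_ge0 ?exprn_ge0 ?(ltW t2_gt0) //.
      by apply: near_0; [rewrite zt | exact: in_cover].
    rewrite exprS invfM mulrCA mulVKf ?gt_eqF // ler_wpM2l // invX_le //.
  rewrite GE'; move: h; set A := (X in nm X <= _) => h.
  by have := nm_subl 1 A; rewrite nm1 nmC; lra.
have : nm (circ_avg N p t2 G) <= eps + e * (2 / rho) ^+ n + e * (2 ^+ n.+1 / 16).
  have -> : circ_avg N p t2 G = - total_avg p t1 t2 bs N G + circ_avg N p t1 G
     - \sum_(b <- bs) circ_avg N b.1 b.2 G by rewrite /total_avg; ring.
  apply: le_trans (nmB _ _) _; apply: lerD => //.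
  by apply: le_trans (nmD _ _) _; apply: lerD; rewrite ?nmN.
by lra.
Qed.

End LowerBound.

(** * Barrier functions *)

Section RingFactors.
Variable R : realType.
Local Notation C := R[i].
Implicit Types (w : C) (k n : nat).

(** Decreases from 2 to 1; the odd terms are the radii of the rings, the even terms separate
    consecutive rings. *)
Definition theta n : R := 1 + (2 ^+ n)^-1.

(* [ring_order k] is large enough for [ring_factor k] to be within [2 ^- (2k+9)]
   of [0] for [nm w <= theta (2k+2)] and of [1] for [theta (2k) <= nm w]; the
   successive rings therefore do not interfere. *)
Definition ring_order k : nat := (2 ^ (k.*2 + 3) * (k.*2 + 10))%N.

Definition ring_radius k : R := theta (k.*2).+1.

(** Over the [ring_order k] holes of a ring this sums to 1 / ((k+1)(k+2)), hence to 1 over all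
    rings. *)
Definition ring_hole k : R := ((k.+1 * k.+2 * ring_order k)%N%:R)^-1.

Definition ring_factor k w : C :=
  w ^+ ring_order k / (w ^+ ring_order k - (ring_radius k)%:C ^+ ring_order k).

Definition off_holes (eps : R) w := forall k i, (i < ring_order k)%N ->
  eps * ring_hole k <= nm (w - (ring_radius k)%:C * zeta R (ring_order k) ^+ i).

Lemma ring_order_gt0 k : (0 < ring_order k)%N.
Proof. by rewrite /ring_order muln_gt0 expn_gt0 /=; lia. Qed.

Lemma ring_hole_gt0 k : 0 < ring_hole k.
Proof. by rewrite invr_gt0 ltr0n muln_gt0 ring_order_gt0. Qed.

Lemma ring_hole_le1 k : ring_hole k <= 1.
Proof.
by rewrite invf_le1 ?ltr0n ?ler1n muln_gt0 ring_order_gt0.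
Qed.

Lemma inv2X_le1 n : (2 ^+ n)^-1 <= 1 :> R.
Proof. by rewrite invf_le1 ?exprn_gt0 // exprn_ege1 ?ler1n. Qed.

Lemma inv2X_le m n : (m <= n)%N -> (2 ^+ n)^-1 <= (2 ^+ m)^-1 :> R.
Proof. by move=> mn; rewrite lef_pV2 ?posrE ?exprn_gt0 // ler_weXn2l ?ler1n. Qed.

Lemma inv2X_half n : (2 ^+ n.+1)^-1 = (2 ^+ n)^-1 / 2 :> R.
Proof. by rewrite exprSr invfM. Qed.

Lemma inv2X_dbl n : 2 * (2 ^+ n.+1)^-1 = (2 ^+ n)^-1 :> R.
Proof. by rewrite inv2X_half mulrC divfK ?pnatr_eq0. Qed.

Lemma inv2X_gt0 n : 0 < (2 ^+ n)^-1 :> R.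
Proof. by rewrite invr_gt0 exprn_gt0. Qed.

Lemma theta_gt1 n : 1 < theta n.
Proof. by rewrite /theta ltrDl invr_gt0 exprn_gt0. Qed.

Lemma theta_gt0 n : 0 < theta n.
Proof. exact: lt_trans (theta_gt1 n). Qed.

Lemma theta_anti m n : (m <= n)%N -> theta n <= theta m.
Proof.
by move=> mn; rewrite lerD2l lef_pV2 ?posrE ?exprn_gt0 // ler_weXn2l ?ler1n.
Qed.

(** With x = 2^-(n+2), theta n is at least (1 + x) theta (n+1), and Bernoulli's inequality gives (1
    + x)^M >= 2 because M x >= 1. *)
Lemma theta_ratio k n : (n <= k.*2.+1)%N ->
  2 * theta n.+1 ^+ (2 ^ (k.*2 + 3)) <= theta n ^+ (2 ^ (k.*2 + 3)).
Proof.
move=> nk; set M := (2 ^ (k.*2 + 3))%N.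
pose x : R := (2 ^+ n.+2)^-1.
have x0 : 0 < x by rewrite invr_gt0 exprn_gt0.
have x4 : x <= 4^-1.
  have -> : 4^-1 = (2 ^+ 2)^-1 :> R by rewrite -natrX.
  exact: inv2X_le.
have Mx : 1 <= M%:R * x.
  rewrite ler_pdivlMr ?exprn_gt0 // mul1r /M natrX ler_weXn2l ?ler1n //; lia.
have h : (1 + x) * theta n.+1 <= theta n.
  rewrite /theta; have -> : (2 ^+ n.+1 : R)^-1 = 2 * x.
    by rewrite /x inv2X_dbl.
  have -> : (2 ^+ n : R)^-1 = 4 * x.
    by rewrite /x -[in LHS]inv2X_dbl -inv2X_dbl mulrA -natrM.
  nra.
apply: le_trans (_ : ((1 + x) * theta n.+1) ^+ M <= _).
  rewrite exprMn ler_wpM2r ?exprn_ge0 ?(ltW (theta_gt0 _)) //.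
  by apply: le_trans (bernoulli_ge M (ltW x0)); lra.
by rewrite lerXn2r ?nnegrE ?mulr_ge0 ?(ltW (theta_gt0 _)) // addr_ge0 // ltW.
Qed.

Lemma theta_ratioX k n s (y z : R) : (n <= k.*2.+1)%N ->
  0 <= y <= theta n.+1 -> theta n <= z ->
  (y / z) ^+ (2 ^ (k.*2 + 3) * s) <= (2 ^+ s)^-1.
Proof.
move=> nk /andP[y0 yt] tz; have t0 := theta_gt0 n.
have z0 : 0 < z := lt_le_trans t0 tz.
rewrite exprM -exprVn; apply: lerXn2r; rewrite ?nnegrE ?invr_ge0 ?exprn_ge0 ?divr_ge0 ?(ltW z0) //.
set M := (2 ^ _)%N; rewrite expr_div_n ler_pdivrMr ?exprn_gt0 //.
apply: le_trans (_ : theta n.+1 ^+ M <= _).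
  by rewrite lerXn2r ?nnegrE ?(ltW (theta_gt0 _)).
rewrite ler_pdivlMl //; apply: le_trans (theta_ratio nk) _.
by rewrite lerXn2r ?nnegrE ?(ltW z0) ?(ltW t0).
Qed.

Lemma ring_factor_near k w : nm w <= theta k.+1.*2 ->
  nm (ring_factor k w) <= (2 ^+ (k.*2 + 9))^-1.
Proof.
move=> wt; pose N := ring_order k; pose r := (ring_radius k)%:C : C.
have r0 : r != 0.
  by rewrite -nm_gt0 nm_real normr_gt0 gt_eqF // theta_gt0.
pose v := (w / r) ^+ N.
have vN : nm v <= (2 ^+ (k.*2 + 10))^-1.
  rewrite /v nmX nmM nmV nm_real gtr0_norm ?theta_gt0 //.
  apply: (@theta_ratioX k (k.*2).+1) => //.
  by rewrite nm_ge0.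
have v2 : nm v <= 2^-1.
  by apply: le_trans vN _; rewrite -[2^-1]/((2 ^+ 1)^-1) inv2X_le // addnS.
have -> : ring_factor k w = - (v / (1 - v)).
  rewrite /ring_factor -/N -/r /v expr_div_n; set a := w ^+ N; set b := r ^+ N.
  have b0 : b != 0 by rewrite expf_neq0.
  (* If the denominator vanishes, both sides are 0 because the inverse of 0 is 0. *)
  have [ab|ab] := eqVneq a b.
    by rewrite ab divff // !subrr invr0 !mulr0 oppr0.
  have ab' : a - b != 0 by rewrite subr_eq0.
  have ba' : b - a != 0 by rewrite subr_eq0 eq_sym.
  by field; rewrite ?b0 ?ab' ?ba'.
rewrite nmN; apply: le_trans (nm_div1B v2) _.
have -> : (2 ^+ (k.*2 + 9))^-1 = 2 * (2 ^+ (k.*2 + 10))^-1 :> R.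
  have -> : (k.*2 + 10 = (k.*2 + 9).+1)%N by lia.
  by rewrite inv2X_dbl.
by rewrite ler_pM2l.
Qed.

Lemma ring_factor_far k w (e : R) :
  nm (((ring_radius k)%:C / w) ^+ ring_order k) <= e -> e <= 2^-1 -> w != 0 ->
  nm (ring_factor k w - 1) <= 2 * e.
Proof.
move=> ve e2 w0; pose N := ring_order k; pose r := (ring_radius k)%:C : C.
pose v := (r / w) ^+ N.
have v2 : nm v <= 2^-1 by exact: le_trans ve e2.
have -> : ring_factor k w - 1 = v / (1 - v).
  have v1 : 1 - v != 0.
    rewrite subr_eq0; apply: contraTneq v2 => <-; rewrite nm1 -ltNge.
    by rewrite invf_lt1 // ltr1n.
  rewrite /ring_factor -/N -/r; move: v1; rewrite /v expr_div_n.
  set a := w ^+ N; set b := r ^+ N.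
  have a0 : a != 0 by rewrite expf_neq0.
  move=> v1; have ab : a - b != 0.
    by apply: contraNneq v1 => /subr0_eq <-; rewrite divff // subrr.
  by field; rewrite a0 ab.
by apply: le_trans (nm_div1B v2) _; rewrite ler_pM2l.
Qed.

Lemma ring_factor_outside k w : theta k.*2 <= nm w ->
  nm (ring_factor k w - 1) <= (2 ^+ (k.*2 + 9))^-1.
Proof.
move=> tw; have w0 : w != 0 by rewrite -nm_gt0 (lt_le_trans (theta_gt0 _) tw).
have -> : (2 ^+ (k.*2 + 9))^-1 = 2 * (2 ^+ (k.*2 + 10))^-1 :> R.
  have -> : (k.*2 + 10 = (k.*2 + 9).+1)%N by lia.
  by rewrite inv2X_dbl.
apply: ring_factor_far => //.
  rewrite nmX nmM nmV nm_real gtr0_norm ?theta_gt0 //.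
  by apply: (@theta_ratioX k (k.*2)) => //; rewrite lexx (ltW (theta_gt0 _)).
by rewrite -[2^-1]/((2 ^+ 1)^-1) inv2X_le // addnS.
Qed.

Lemma ring_factor_very_far k w : 2 <= nm w ->
  nm (ring_factor k w - 1) <= (2 ^+ k.+3)^-1 / nm w.
Proof.
move=> tw; have nw0 : 0 < nm w by apply: lt_le_trans tw.
have w0 : w != 0 by rewrite -nm_gt0.
have t2 : theta 0 = 2 by rewrite /theta expr0 invr1.
have t32 : ring_radius k <= 3 / 2.
  apply: le_trans (theta_anti (ltn0Sn _)) _; rewrite /theta expr1; lra.
pose x := ring_radius k / nm w.
have x0 : 0 <= x by rewrite divr_ge0 ?(ltW nw0) ?(ltW (theta_gt0 _)).
have x1 : x <= (3 / 2) / nm w by rewrite ler_pM2r ?invr_gt0.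
have x1' : x <= 1 by apply: le_trans x1 _; rewrite ler_pdivrMr //; lra.
pose e := (2 ^+ (k + 5))^-1 * ((3 / 2) / nm w).
have e2 : e <= 2^-1.
  have -> : 2^-1 = 2^-1 * 1 :> R by rewrite mulr1.
  apply: ler_pM; rewrite ?invr_ge0 ?exprn_ge0 ?divr_ge0 ?(ltW nw0) //.
    by rewrite -[2^-1]/((2 ^+ 1)^-1) inv2X_le // addnS.
  by rewrite ler_pdivrMr //; lra.
apply: le_trans (ring_factor_far (e := e) _ e2 w0) _.
  rewrite nmX nmM nmV nm_real gtr0_norm ?theta_gt0 // -/x /ring_order.
  (* Half of the exponent yields the factor 2^-(k+5); from the other half a single [x] is kept,
     which carries the decay in [nm w]. *)
  have -> : (k.*2 + 10 = (k + 5) + (k + 5))%N by lia.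
  rewrite mulnDr exprD; apply: ler_pM; rewrite ?exprn_ge0 //.
    apply: (@theta_ratioX k 0) => //; last by rewrite t2.
    by rewrite (ltW (theta_gt0 _)) theta_anti.
  apply: le_trans x1; rewrite -{2}[x]expr1; apply: ler_wiXn2l => //.
  by rewrite muln_gt0 expn_gt0 addn_gt0 orbT.
rewrite /e; have -> : (k + 5 = k.+3.+2)%N by lia.
rewrite 2!inv2X_half; set y := (2 ^+ k.+3)^-1; set z := (nm w)^-1.
have y0 : 0 < y by rewrite invr_gt0 exprn_gt0.
have z0 : 0 < z by rewrite invr_gt0.
by have := mulr_gt0 y0 z0; nra.
Qed.

Lemma inv_ring_hole k : (ring_hole k)^-1 <= 2 ^+ (5 * k + 8).
Proof.
rewrite /ring_hole invrK /ring_order -natrX ler_nat.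
have h j : (j < 2 ^ j)%N by exact: ltn_expl.
have -> : (2 ^ (5 * k + 8) = 2 ^ k * 2 ^ k.+1 * (2 ^ (k.*2 + 3) * 2 ^ (k + 4)))%N.
  by rewrite -!expnD; congr (2 ^ _)%N; lia.
apply: leq_mul; first by apply: leq_mul; exact: h.
by apply: leq_mul => //; rewrite expnD; have := h k; lia.
Qed.

Lemma off_holes_neq0 k w eps : 0 < eps -> off_holes eps w ->
  w ^+ ring_order k - (ring_radius k)%:C ^+ ring_order k != 0.
Proof.
move=> e0 woff; set N := ring_order k; set r := ring_radius k.
have N0 : (0 < N)%N := ring_order_gt0 k.
apply/negP => /eqP /subr0_eq wr.
have rn0 : r%:C != 0 :> C by rewrite -nm_gt0 nm_real normr_gt0 gt_eqF ?theta_gt0.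
have : (w / r%:C) ^+ N = 1 by rewrite expr_div_n wr divff // expf_neq0.
move=> /(prim_rootP (zetaP R N0)) [i wi].
have := woff k i (ltn_ord i); rewrite -wi mulrCA divff // mulr1 subrr nm0.
by rewrite leNgt mulr_gt0 ?ring_hole_gt0.
Qed.

(** [circ_avg_pole_neq] read backwards: 1 - ring_factor k w is the average of 1 / (z - w) over the
    centres of the holes of the ring, where [off_holes] bounds |z - w| from below. This makes the
    bound linear in 1 / eps. *)
Lemma ring_factor_bound k w eps : 0 < eps <= 1 -> off_holes eps w ->
  nm (ring_factor k w) <= 2 ^+ (5 * k + 10) / eps.
Proof.
move=> /andP[e0 e1] woff; pose N := ring_order k; pose r : R := ring_radius k.
have N0 : (0 < N)%N := ring_order_gt0 k.
have r0 : 0 < r := theta_gt0 _.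
have r2 : r <= 2 by apply: le_trans (theta_anti (leq0n _)) _; rewrite /theta expr0 invr1.
have wk i : (i < N)%N -> eps * ring_hole k <= nm (r%:C * zeta R N ^+ i - w).
  by move=> iN; rewrite nmC; exact: woff.
have et0 : 0 < eps * ring_hole k by rewrite mulr_gt0 ?ring_hole_gt0.
have den : r%:C ^+ N - (w - 0) ^+ N != 0.
  by rewrite subr0 -opprB oppr_eq0; exact: off_holes_neq0 woff.
have avg := circ_avg_pole_neq (ltW r0) N0 den.
have := @nm_circ_avg_nodes R N 0 r (fun z => (z - w)^-1) (eps * ring_hole k)^-1 (ltW r0) N0.
rewrite avg subr0 => bound.
have {}bound : nm (r%:C ^+ N / (r%:C ^+ N - w ^+ N)) <= r / (eps * ring_hole k).
  apply: bound => i iN; rewrite add0r nmV lef_pV2 ?posrE ?wk //.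
  exact: lt_le_trans (wk i iN).
have -> : ring_factor k w = 1 - r%:C ^+ N / (r%:C ^+ N - w ^+ N).
  rewrite /ring_factor -/N -/r; rewrite subr0 in den.
  by field; rewrite den -opprB oppr_eq0 den.
apply: le_trans (nmB _ _) _; rewrite nm1.
have := inv_ring_hole k; have := ring_hole_gt0 k.
rewrite invfM mulrCA in bound; set t := ring_hole k in bound et0 * => t0 tk.
have t1 : 1 <= t^-1 by rewrite -[leLHS]invr1 lef_pV2 ?posrE ?ring_hole_le1.
have e1' : 1 <= eps^-1 by rewrite -[leLHS]invr1 lef_pV2 ?posrE.
have -> : (5 * k + 10 = (5 * k + 8).+2)%N by lia.
rewrite 2!exprS [leRHS]mulrC; set X := 2 ^+ _ in tk *.
apply: (@le_trans _ _ (eps^-1 * (3 * t^-1))).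
  apply: (@le_trans _ _ (eps^-1 * t^-1 + eps^-1 * (r * t^-1))).
    by apply: lerD => //; nra.
  rewrite -mulrDr ler_wpM2l ?invr_ge0 ?(ltW e0) //; nra.
by rewrite ler_wpM2l ?invr_ge0 ?(ltW e0) //; nra.
Qed.

Definition ring_prod n w : C := \prod_(k < n) ring_factor k w.

(** The decay 2^(-8n) of the earlier rings absorbs the growth 2^(5n+10) of the next factor near its
    own ring. *)
Lemma ring_prod_inside n w : nm w <= theta n.*2 ->
  nm (ring_prod n w) <= (2 ^+ (8 * n))^-1.
Proof.
move=> wn; rewrite nm_prod exprM -exprVn.
rewrite -[X in _ <= X ^+ _]/((2 ^+ 8)^-1) -[n in leRHS]card_ord -prodr_const.
apply: ler_prod => k _; rewrite nm_ge0 /=.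
apply: le_trans (ring_factor_near _) _.
  by apply: le_trans wn _; apply: theta_anti; have := ltn_ord k; lia.
by rewrite lef_pV2 ?posrE ?exprn_gt0 // ler_weXn2l ?ler1n //; lia.
Qed.

(** The term 2 - 2^-n strengthens the induction: it leaves room for a factor 1 + 2^-(2n+9) when [w]
    is outside the new ring. Otherwise the product of the previous factors is tiny and only the new
    factor matters. *)
Lemma ring_prod_bound n w eps : 0 < eps <= 1 -> off_holes eps w ->
  nm (ring_prod n w) <= 2 ^+ 10 / eps * (2 - (2 ^+ n)^-1).
Proof.
move=> e01 woff; have /andP[e0 e1] := e01.
have e1' : 1 <= eps^-1 by rewrite -[leLHS]invr1 lef_pV2 ?posrE.
elim: n => [|n IH].
  rewrite /ring_prod big_ord0 nm1 expr0 invr1.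
  have : (1 : R) <= 2 ^+ 10 by rewrite exprn_ege1 ?ler1n.
  nra.
rewrite /ring_prod big_ord_recr /= nmM -/(ring_prod n w).
have [wn|wn] := leP (theta n.*2) (nm w).
  have h := ring_factor_outside wn.
  have h' : nm (ring_factor n w) <= 1 + (2 ^+ (n.*2 + 9))^-1.
    by rewrite -{1}[ring_factor n w](subrK 1) (le_trans (nmD _ _)) // nm1 addrC lerD2l.
  apply: le_trans (ler_pM (nm_ge0 _) (nm_ge0 _) IH h') _.
  rewrite -[leLHS]mulrA ler_wpM2l ?divr_ge0 ?exprn_ge0 ?(ltW e0) //.
  have -> : (2 ^+ (n.*2 + 9))^-1 = (2 ^+ n)^-1 * (2 ^+ (n + 9))^-1 :> R.
    by rewrite -invfM -exprD; congr (_ ^+ _)^-1; lia.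
  have z4 : (2 ^+ (n + 9))^-1 <= 2^-1 / 2 :> R.
    by rewrite -[2^-1]/((2 ^+ 1)^-1) -inv2X_half inv2X_le // !addnS.
  rewrite inv2X_half; have y0 := inv2X_gt0 n; have z0 := inv2X_gt0 (n + 9).
  by have y1 := inv2X_le1 n; nra.
have h1 := ring_prod_inside (ltW wn).
have h2 := ring_factor_bound n e01 woff.
apply: le_trans (ler_pM (nm_ge0 _) (nm_ge0 _) h1 h2) _.
rewrite mulrA; have := inv2X_le1 n.+1; set y := (2 ^+ n.+1)^-1 => y1.
apply: (@le_trans _ _ (2 ^+ 10 / eps * 1)).
  rewrite mulr1 ler_wpM2r ?invr_ge0 ?(ltW e0) //.
  rewrite exprD mulrA ler_piMl ?exprn_ge0 // ler_pdivrMl ?exprn_gt0 // mulr1.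
  by rewrite ler_weXn2l ?ler1n // leq_mul2r orbT.
by rewrite ler_wpM2l ?divr_ge0 ?exprn_ge0 ?(ltW e0) //; lra.
Qed.

Lemma ring_prod_bound' n w eps : 0 < eps <= 1 -> off_holes eps w ->
  nm (ring_prod n w) <= 2 ^+ 11 / eps.
Proof.
move=> e01 woff; have /andP[e0 e1] := e01.
apply: le_trans (ring_prod_bound n e01 woff) _.
have -> : 2 ^+ 11 / eps = 2 ^+ 10 / eps * 2 by rewrite exprSr mulrAC.
rewrite ler_wpM2l ?divr_ge0 ?exprn_ge0 ?(ltW e0) //.
by have := inv2X_gt0 n; lra.
Qed.

(** Either the new factor is close to 1, or the previous product is small enough to beat it. The
    steps are summable, which gives the limit in [barrier]. *)
Lemma ring_prod_step n w eps : 0 < eps <= 1 -> off_holes eps w ->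
  nm (ring_prod n.+1 w - ring_prod n w) <= 2 ^+ 11 / eps * (2 ^+ n)^-1.
Proof.
move=> e01 woff; have /andP[e0 e1] := e01.
have e1' : 1 <= eps^-1 by rewrite -[leLHS]invr1 lef_pV2 ?posrE.
have -> : ring_prod n.+1 w - ring_prod n w = ring_prod n w * (ring_factor n w - 1).
  by rewrite /ring_prod big_ord_recr /= mulrBr mulr1.
rewrite nmM; have [wn|wn] := leP (theta n.*2) (nm w).
  have h := ring_factor_outside wn.
  apply: le_trans (ler_pM (nm_ge0 _) (nm_ge0 _) (ring_prod_bound' n e01 woff) h) _.
  by rewrite ler_wpM2l ?divr_ge0 ?exprn_ge0 ?(ltW e0) // inv2X_le //; lia.
have h1 := ring_prod_inside (ltW wn).
have h2 : nm (ring_factor n w - 1) <= 2 ^+ (5 * n + 11) / eps.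
  apply: le_trans (nmB _ _) _; rewrite nm1 (_ : 5 * n + 11 = (5 * n + 10).+1)%N; last lia.
  have := ring_factor_bound n e01 woff.
  have : (1 : R) <= 2 ^+ (5 * n + 10) by rewrite exprn_ege1 ?ler1n.
  by rewrite exprSr mulrAC => h3 h4; nra.
apply: le_trans (ler_pM (nm_ge0 _) (nm_ge0 _) h1 h2) _.
rewrite mulrA [leRHS]mulrAC ler_wpM2r ?invr_ge0 ?(ltW e0) //.
rewrite exprD mulrA [leRHS]mulrC ler_wpM2r ?exprn_ge0 //.
rewrite ler_pdivrMl ?exprn_gt0 // ler_pdivlMr ?exprn_gt0 // -exprD.
by rewrite ler_weXn2l ?ler1n //; lia.
Qed.

(** The bound keeps the product below 2 in modulus, so the next step adds at most 2^-(n+2) / |w|,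
    within the increment of 1 - 2^-n. *)
Lemma ring_prod_outside n w : 2 <= nm w ->
  nm (ring_prod n w - 1) <= (1 - (2 ^+ n)^-1) / nm w.
Proof.
move=> w2; have nw0 : 0 < nm w by apply: lt_le_trans w2.
have w1 : (nm w)^-1 <= 2^-1 by rewrite lef_pV2 ?posrE.
have w0 : 0 < (nm w)^-1 by rewrite invr_gt0.
elim: n => [|n IH].
  by rewrite /ring_prod big_ord0 subrr nm0 expr0 invr1 subrr mul0r.
have p2 : nm (ring_prod n w) <= 2.
  rewrite -{1}[ring_prod n w](subrK 1); apply: le_trans (nmD _ _) _; rewrite nm1.
  by have := inv2X_gt0 n; nra.
have -> : ring_prod n.+1 w - 1 = ring_prod n w * (ring_factor n w - 1) + (ring_prod n w - 1).
  by rewrite /ring_prod big_ord_recr /= mulrBr mulr1 addrA subrK.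
have h := ring_factor_very_far n w2.
apply: le_trans (nmD _ _) _; rewrite nmM.
have := ler_pM (nm_ge0 _) (nm_ge0 _) p2 h.
rewrite 3!inv2X_half in IH *; have := inv2X_gt0 n.
set y := (2 ^+ n)^-1 in IH *; set u := (nm w)^-1 in IH w1 w0 *.
by move=> y0 h'; nra.
Qed.

End RingFactors.

(** * The algebra of a compact plane set *)

Section UniformAlgebra.
Variable R : realType.
Local Notation C := R[i].

Lemma nbhs_nmP (x : C^o) (A : set C^o) :
  nbhs x A <-> exists2 d : R, 0 < d & forall y, nm (y - x) < d -> A y.
Proof.
split=> [/(@nbhs_ballP _ C^o)[d d0 dA]|[d d0 dA]].
  have dR := RRe_real (gtr0_real d0); exists (complex.Re d).
    by rewrite -ltcR dR.
  move=> y yx; apply: dA; rewrite -ball_normE /= distrC normC_nm -dR.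
  by rewrite ltcR.
apply/(@nbhs_ballP _ C^o); exists d%:C; first by rewrite /= ltcR.
move=> y; rewrite -ball_normE /= distrC normC_nm ltcR; exact: dA.
Qed.

Lemma nbhs_subP (K : set C^o) (x : K) (A : set K) :
  nbhs x A <-> exists2 d : R, 0 < d &
    forall y : K, nm ((set_val y : C) - set_val x) < d -> A y.
Proof.
split.
  rewrite nbhsE => -[_ [[B Bo <-] Bx] BA].
  have /nbhs_nmP[d d0 dB] : nbhs (set_val x : C^o) B by exact: open_nbhs_nbhs.
  by exists d => // y yx; apply: BA; exact: dB.
move=> [d d0 dA].
have xd : nbhs (set_val x : C^o) [set y : C^o | nm ((y : C) - set_val x) < d].
  by apply/nbhs_nmP; exists d.
have xdK := @initial_continuous K C^o set_val x _ xd.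
by apply: (@filterS _ (nbhs x) _ _ A _ xdK) => y; exact: dA.
Qed.

Lemma uniform_closureP (X : topologicalType) (S : set (X -> C^o)) f :
  uniform_closure S f <->
  forall e : R, 0 < e -> exists2 g, S g & forall x, nm (f x - g x : C) < e.
Proof.
split=> [fS e e0|fS B /uniform_nbhs[E [entE EB]]].
  have [|g [Sg gB]] := fS [set g | forall x, nm (f x - g x : C) < e].
    apply/uniform_nbhs; exists [set xy : C^o * C^o | ball xy.1 e%:C xy.2].
    split; first by rewrite -entourage_ballE; exists e%:C => //=; rewrite ltcR.
    by move=> g gE x; have := gE x I; rewrite -ball_normE /= normC_nm ltcR.
  by exists g.
move: entE; rewrite -entourage_ballE => -[d /= d0 dE].
have dR := RRe_real (gtr0_real d0).
have [|g Sg gd] := fS (complex.Re d); first by rewrite -ltcR dR.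
exists g; split => //; apply: EB => x _; apply: dE => /=.
by rewrite -ball_normE /= normC_nm -dR ltcR.
Qed.

Lemma RK_approx (K : set C^o) f : RK K f <-> forall e : R, 0 < e ->
  exists p q : {poly C}, (forall z, K z -> q.[z] != 0) /\
    forall z : K, nm (f z - p.[set_val z] / q.[set_val z] : C) < e.
Proof.
rewrite /RK uniform_closureP; split=> fK e /fK.
  move=> [g [p [q [qK gpq]]] fg]; exists p, q; split => // z.
  by rewrite -gpq.
move=> [p [q [qK fpq]]]; exists (fun z : K => p.[set_val z] / q.[set_val z]) => //.
by exists p, q.
Qed.

End UniformAlgebra.

(** * R(K) as an algebra, and a cut-off criterion for powers of M_x *)

Section RationalAlgebra.
Variable R : realType.
Local Notation C := R[i].
Variables (K : set C^o) (M : R).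
Hypothesis K_bounded : forall z, K z -> nm z <= M.
Hypothesis K_closed : forall a, ~ K a ->
  exists2 e : R, 0 < e & forall z, K z -> e <= nm (z - a).
Implicit Types (f g : K -> C^o) (p q : {poly C}).

Lemma set_val_in (z : K) : K (set_val z).
Proof. exact: set_valP. Qed.

Lemma rational_bounded p q : (forall z, K z -> q.[z] != 0) ->
  exists2 B : R, 0 < B & forall z, K z -> nm (p.[z] / q.[z]) <= B.
Proof.
move=> qK; have [d d0 dP] := poly_away_from_roots K_closed qK.
have [B B0 BP] := poly_bounded 0 p M.
exists (B / d); first exact: divr_gt0.
move=> z Kz; rewrite nmM nmV ler_pM ?invr_ge0 ?nm_ge0 //.
  by apply: BP; rewrite subr0 K_bounded.
rewrite lef_pV2 ?posrE ?dP //; exact: lt_le_trans (dP _ Kz).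
Qed.

Lemma RK_bounded f : RK K f -> exists2 B : R, 0 < B & forall z, nm (f z : C) <= B.
Proof.
move=> /RK_approx /(_ 1 ltr01)[p [q [qK fpq]]].
have [B B0 BP] := rational_bounded p qK.
exists (B + 1); first by rewrite addr_gt0.
move=> z; have := fpq z; have := BP _ (set_val_in z).
set r := _ / _ => h1 h2; rewrite -[f z](subrK r).
by apply: le_trans (nmD _ _) _; lra.
Qed.

Lemma RK_rational p q : (forall z, K z -> q.[z] != 0) ->
  RK K (fun z => p.[set_val z] / q.[set_val z]).
Proof.
move=> qK; apply/RK_approx => e e0; exists p, q; split=> // z.
by rewrite subrr nm0.
Qed.

Lemma RK_cst (c : C) : RK K (fun=> c).
Proof.
apply/RK_approx => e e0; exists c%:P, 1; split=> [z _|z].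
  by rewrite hornerC oner_eq0.
by rewrite !hornerC divr1 subrr nm0.
Qed.

Lemma RK_add f g : RK K f -> RK K g -> RK K (fun z => f z + g z).
Proof.
move=> /RK_approx fK /RK_approx gK; apply/RK_approx => e e0.
have e2 : 0 < e / 2 by rewrite divr_gt0.
have [p [q [qK fpq]]] := fK _ e2; have [p' [q' [q'K gpq]]] := gK _ e2.
exists (p * q' + p' * q), (q * q'); split=> [z Kz|z].
  by rewrite hornerM mulf_neq0 ?qK ?q'K.
have q0 := qK _ (set_val_in z); have q'0 := q'K _ (set_val_in z).
have := fpq z; have := gpq z; move: (set_val z : C) q0 q'0 => a q0 q'0.
move: (f z : C) (g z : C) => s t h1 h2.
have -> : s + t - (p * q' + p' * q).[a] / (q * q').[a] =
    (s - p.[a] / q.[a]) + (t - p'.[a] / q'.[a]).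
  rewrite hornerD !hornerM; move: p.[a] q.[a] p'.[a] q'.[a] q0 q'0 {h1 h2}.
  by move=> a1 a2 a3 a4 n2 n4; field; rewrite n2 n4.
by apply: le_lt_trans (nmD _ _) _; lra.
Qed.

Lemma RK_mul f g : RK K f -> RK K g -> RK K (fun z => f z * g z).
Proof.
move=> fK gK; have [B B0 fB] := RK_bounded fK; have [B' B'0 gB] := RK_bounded gK.
apply/RK_approx => e e0.
(* Errors below [d <= 1] in both factors change the product by less than d B' + (B + d) d, at most d
   (B + B' + 1). *)
pose d := Num.min 1 (e / (B + B' + 1)).
have S0 : 0 < B + B' + 1 by rewrite !addr_gt0.
have d0 : 0 < d by rewrite lt_min ltr01 divr_gt0.
have d1 : d <= 1 by rewrite ge_min lexx.
have de : d * (B + B' + 1) <= e by rewrite -ler_pdivlMr // ge_min lexx orbT.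
move/RK_approx: fK => /(_ _ d0)[p [q [qK fpq]]].
move/RK_approx: gK => /(_ _ d0)[p' [q' [q'K gpq]]].
exists (p * p'), (q * q'); split=> [z Kz|z].
  by rewrite hornerM mulf_neq0 ?qK ?q'K.
have q0 := qK _ (set_val_in z); have q'0 := q'K _ (set_val_in z).
have h1 := fpq z; have h2 := gpq z; have h3 := fB z; have h4 := gB z.
move: (set_val z : C) q0 q'0 h1 h2 => a q0 q'0.
rewrite !hornerE invfM mulrACA; set u := p.[a] / q.[a]; set v := p'.[a] / q'.[a].
move: (f z : C) (g z : C) h3 h4 => x y xB yB xu yv.
have -> : x * y - u * v = (x - u) * y + (x - (x - u)) * (y - v) by ring.
apply: le_lt_trans (nmD _ _) _; rewrite !nmM.
have h5 := nmB x (x - u).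
have := nm_ge0 (x - u); have := nm_ge0 (y - v); have := nm_ge0 y.
by have := nm_ge0 (x - (x - u)); nra.
Qed.

Lemma RK_sum n (c : 'I_n -> C) (s : 'I_n -> K -> C^o) :
  (forall i, RK K (s i)) -> RK K (\sum_(i < n) c i *: s i).
Proof.
move=> sK; elim/big_ind: _ => [|f g fK gK|i _].
- exact: RK_cst.
- exact: RK_add.
- by apply: RK_mul => //; exact: RK_cst.
Qed.

Lemma RK_prod n (g : 'I_n -> K -> C^o) :
  (forall i, RK K (g i)) -> RK K (\prod_(i < n) g i).
Proof.
move=> gK; elim/big_ind: _ => [|f h fK hK|i _]; last exact: gK.
- exact: RK_cst.
- exact: RK_mul.
Qed.

Variable x : K.

(** The value at [x] of a rational approximant is small; subtracting it makes the numerator vanish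
    at [x], so X - x factors out. *)
Lemma vanishing_approx f e : 0 < e -> RK K f -> f x = 0 ->
  exists p q, [/\ (forall z, K z -> q.[z] != 0) &
    forall z : K, nm (f z - (p * ('X - (set_val x)%:P)).[set_val z] / q.[set_val z] : C) < e].
Proof.
move=> e0 /RK_approx fK fx0; have e2 : 0 < e / 2 by rewrite divr_gt0.
have [p [q [qK fpq]]] := fK _ e2.
have hx := fpq x; rewrite fx0 sub0r nmN in hx.
have qx := qK _ (set_val_in x).
move: (set_val x : C) qx hx => a qx hx.
pose p1 := p - (p.[a] / q.[a])%:P * q.
have /factor_theorem[u p1E] : root p1 a.
  by rewrite rootE /p1 !hornerE mulfVK ?subrr.
exists u, q; split=> // z; rewrite -p1E.
have h := fpq z; have q0 := qK _ (set_val_in z).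
move: (set_val z : C) q0 h => b q0 h.
have -> : (f z : C) - p1.[b] / q.[b] = (f z - p.[b] / q.[b]) + p.[a] / q.[a].
  by rewrite /p1 !hornerE; field; rewrite qx q0.
by apply: le_lt_trans (nmD _ _) _; lra.
Qed.

(** Multiplying the approximants of [vanishing_approx] produces a zero of order [m] at [x], the only
    trace of M_x^m used by the cut-off argument. *)
Lemma prod_approx m (g : 'I_m -> K -> C^o) e : 0 < e ->
  (forall i, RK K (g i)) -> (forall i, g i x = 0) ->
  exists p q, [/\ (forall z, K z -> q.[z] != 0) &
    forall z : K, nm ((\prod_(i < m) g i) z -
      (p * ('X - (set_val x)%:P) ^+ m).[set_val z] / q.[set_val z] : C) < e].
Proof.
elim: m g e => [|m IH] g e e0 gK gx.
  exists 1, 1; split=> [z _|z]; first by rewrite hornerC oner_eq0.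
  by rewrite big_ord0 mul1r expr0 !hornerC divr1 subrr nm0.
pose G := \prod_(i < m) g (lift ord0 i).
have GK : RK K G by apply: RK_prod.
have [B B0 GB] := RK_bounded GK; have [B' B'0 gB] := RK_bounded (gK ord0).
pose d := Num.min 1 (e / (B + B' + 1)).
have S0 : 0 < B + B' + 1 by rewrite !addr_gt0.
have d0 : 0 < d by rewrite lt_min ltr01 divr_gt0.
have d1 : d <= 1 by rewrite ge_min lexx.
have de : d * (B + B' + 1) <= e by rewrite -ler_pdivlMr // ge_min lexx orbT.
have [p [q [qK Gpq]]] := IH (fun i => g (lift ord0 i)) d d0 (fun i => gK _) (fun i => gx _).
have [p' [q' [q'K gpq]]] := vanishing_approx d0 (gK ord0) (gx ord0).
exists (p * p'), (q * q'); split=> [z Kz|z].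
  by rewrite hornerM mulf_neq0 ?qK ?q'K.
rewrite big_ord_recl -[\prod_(i < m) _]/G.
have h1 := Gpq z; have h2 := gpq z; have h3 := GB z; have h4 := gB z.
rewrite -/G in h1.
have -> : (g ord0 * G) z = (G z : C) * (g ord0 z : C) by rewrite mulrC.
move: (set_val x : C) (set_val z : C) h1 h2 => b a.
have -> : p * p' * ('X - b%:P) ^+ m.+1 = (p * ('X - b%:P) ^+ m) * (p' * ('X - b%:P)).
  by rewrite exprSr; ring.
rewrite [(_ * _ * (p' * _)).[_]]hornerM [(q * q').[_]]hornerM invfM mulrACA.
set u := _ / q.[a]; set v := _ / q'.[a].
move: (G z : C) (g ord0 z : C) h3 h4 => s y xB yB xu yv.
have -> : s * y - u * v = (s - u) * y + (s - (s - u)) * (y - v) by ring.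
apply: le_lt_trans (nmD _ _) _; rewrite !nmM.
have h5 := nmB s (s - u).
have := nm_ge0 (s - u); have := nm_ge0 (y - v); have := nm_ge0 y.
by have := nm_ge0 (s - (s - u)); nra.
Qed.

Lemma J_closure_add f g : uniform_closure (J_ideal (RK K) x) f ->
  uniform_closure (J_ideal (RK K) x) g ->
  uniform_closure (J_ideal (RK K) x) (fun z => f z + g z).
Proof.
move=> /uniform_closureP fJ /uniform_closureP gJ; apply/uniform_closureP => e e0.
have e2 : 0 < e / 2 by rewrite divr_gt0.
have [f' [f'K f'0] ff'] := fJ _ e2; have [g' [g'K g'0] gg'] := gJ _ e2.
exists (fun z => f' z + g' z).
  split; first exact: RK_add.
  apply: filterS (filterI f'0 g'0) => z [/= -> ->]; exact: addr0.
move=> z; have := ff' z; have := gg' z => h1 h2.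
have -> : (f z + g z : C) - (f' z + g' z) = (f z - f' z : C) + (g z - g' z : C).
  by rewrite opprD addrACA.
by apply: le_lt_trans (nmD _ _) _; lra.
Qed.

Lemma J_closure_scale c f : uniform_closure (J_ideal (RK K) x) f ->
  uniform_closure (J_ideal (RK K) x) (fun z => c * f z).
Proof.
move=> /uniform_closureP fJ; apply/uniform_closureP => e e0.
have c0 : 0 < nm c + 1 by rewrite ltr_wpDl ?nm_ge0.
have [f' [f'K f'0] ff'] := fJ _ (divr_gt0 e0 c0).
exists (fun z => c * f' z).
  split; first by apply: RK_mul => //; exact: RK_cst.
  by apply: filterS f'0 => z /= ->; exact: mulr0.
move=> z; have := ff' z; rewrite ltr_pdivlMr // => h.
rewrite -mulrBr nmM; apply: le_lt_trans h.
by have := nm_ge0 (f z - f' z : C); have := nm_ge0 c; nra.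
Qed.

Lemma power_in_closure_cutoff m :
  (forall e : R, 0 < e -> exists2 H, J_ideal (RK K) x H &
     forall z : K, nm ((1 - H z) * ((set_val z : C) - set_val x) ^+ m : C) <= e) ->
  power_in_closure (RK K) x m.
Proof.
move=> cut h [n [c [s [sP ->]]]]; split.
  apply: RK_sum => i; have [g [gP ->]] := sP i.
  by apply: RK_prod => j; have [] := gP j.
elim/big_ind: _ => [|f g fK gK|i _].
- apply/uniform_closureP => e e0; exists (fun=> 0); last by move=> z; rewrite subrr nm0.
  by split; [exact: RK_cst | exact: filterE].
- exact: J_closure_add.
apply: J_closure_scale; have [g [gP ->]] := sP i.
apply/uniform_closureP => e e0; have e2 : 0 < e / 2 by rewrite divr_gt0.
have [p [q [qK gpq]]] := prod_approx e2 (fun j => (gP j).1) (fun j => (gP j).2).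
have [B B0 BP] := rational_bounded p qK.
(* The cut-off is chosen after [p] and [q], since its tolerance depends on the bound [B] of p /
   q. *)
have [H HJ HP] := cut (e / 2 / B) (divr_gt0 e2 B0).
have [HK H0] := HJ.
exists (fun z => H z * ((p * ('X - (set_val x)%:P) ^+ m).[set_val z] / q.[set_val z])).
  split; first by apply: RK_mul => //; exact: RK_rational.
  by apply: filterS H0 => z /= ->; exact: mul0r.
move=> z; have h1 := gpq z; have h2 := HP z; have h3 := BP _ (set_val_in z).
move: (set_val x : C) (set_val z : C) h1 h2 h3 => b a.
have -> : (p * ('X - b%:P) ^+ m).[a] = p.[a] * (a - b) ^+ m by rewrite !hornerE.
move: (H z : C) ((\prod_(i < m) g i) z : C) => t s' h1 h2 h3.
have -> : s' - t * (p.[a] * (a - b) ^+ m / q.[a]) =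
  (s' - p.[a] * (a - b) ^+ m / q.[a]) + p.[a] / q.[a] * ((1 - t) * (a - b) ^+ m).
  by ring.
apply: le_lt_trans (nmD _ _) _; rewrite (nmM (_ / _)).
have h4 : nm (p.[a] / q.[a]) * nm ((1 - t) * (a - b) ^+ m) <= e / 2.
  have -> : e / 2 = B * (e / 2 / B) by rewrite [RHS]mulrC divfK ?gt_eqF.
  by apply: ler_pM => //; exact: nm_ge0.
by lra.
Qed.

End RationalAlgebra.

(** * Limits of sequences with geometrically small steps *)

Section GeometricLimits.
Variable R : realType.
Local Notation C := R[i].

(** The intervals [[lo n, hi n]] are nested, and the supremum of their left ends lies in all of
    them. *)
Lemma geometric_limit (u : nat -> R) (B : R) :
  (forall n, `|u n.+1 - u n| <= B * (2 ^+ n)^-1) ->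
  exists l, forall n, `|l - u n| <= 2 * B * (2 ^+ n)^-1.
Proof.
move=> uB.
have B0 : 0 <= B by have := uB 0%N; rewrite expr0 invr1 mulr1; apply: le_trans.
pose lo n := u n - 2 * B * (2 ^+ n)^-1.
pose hi n := u n + 2 * B * (2 ^+ n)^-1.
have lo_mono m n : (m <= n)%N -> lo m <= lo n.
  move=> /subnK <-; elim: (n - m)%N => // k IH; apply: le_trans IH _.
  rewrite addSn /lo inv2X_half; have := uB (k + m)%N; rewrite ler_norml => /andP[h _].
  by move: h; set y := (2 ^+ _)^-1; lra.
have hi_anti m n : (m <= n)%N -> hi n <= hi m.
  move=> /subnK <-; elim: (n - m)%N => // k IH; apply: le_trans IH.
  rewrite addSn /hi inv2X_half; have := uB (k + m)%N; rewrite ler_norml => /andP[_ h].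
  by move: h; set y := (2 ^+ _)^-1; lra.
have lohi m n : lo m <= hi n.
  apply: le_trans (lo_mono _ _ (leq_maxl m n)) _.
  apply: le_trans (hi_anti _ _ (leq_maxr m n)).
  by rewrite /lo /hi; have := mulr_ge0 B0 (ltW (inv2X_gt0 R (maxn m n))); lra.
pose S : set R := range lo.
have Sub n : ubound S (hi n) by move=> _ [m _ <-]; exact: lohi.
exists (sup S) => n; rewrite ler_norml; apply/andP; split.
  have : lo n <= sup S by apply: ub_le_sup; [exists (hi 0%N); exact: Sub | exists n].
  by rewrite /lo; lra.
have : sup S <= hi n by apply: ge_sup; [exists (lo 0%N); exists 0%N | exact: Sub].
by rewrite /hi; lra.
Qed.

Lemma geometric_limitC (u : nat -> C) (B : R) :
  (forall n, nm (u n.+1 - u n) <= B * (2 ^+ n)^-1) ->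
  exists l, forall n, nm (l - u n) <= 4 * B * (2 ^+ n)^-1.
Proof.
move=> uB.
have ReB (x y : C) : complex.Re (x - y) = complex.Re x - complex.Re y by case: x y => [a b] [].
have ImB (x y : C) : complex.Im (x - y) = complex.Im x - complex.Im y by case: x y => [a b] [].
have [|a aP] := @geometric_limit (fun n => complex.Re (u n)) B.
  by move=> n; rewrite -ReB; apply: le_trans (nm_re _) _.
have [|b bP] := @geometric_limit (fun n => complex.Im (u n)) B.
  by move=> n; rewrite -ImB; apply: le_trans (nm_im _) _.
exists (a +i* b) => n; apply: le_trans (nm_le_re_im _) _.
by rewrite ReB ImB; have := aP n; have := bP n; rewrite /=; lra.
Qed.

Lemma le_geometric (x y B : R) : (forall n, x <= y + B * (2 ^+ n)^-1) -> x <= y.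
Proof.
move=> h; apply/ler_addgt0Pr => e e0.
have [|B0] := leP B 0.
  by move=> B0; have := h 0%N; rewrite expr0 invr1; lra.
have [|N /(_ N (leqnn _))] := @expr_small R 2^-1 (e / B) _ (divr_gt0 e0 B0).
  by rewrite invr_ge0 ler0n invf_lt1 // ltr1n.
rewrite exprVn ler_pdivlMr // mulrC => hN.
by apply: le_trans (h N) _; rewrite lerD2l.
Qed.

End GeometricLimits.

(** * The barrier function as an element of R(K) *)

Section Barrier.
Variable R : realType.
Local Notation C := R[i].
Variables (K : set C^o) (a : C) (r eps : R).
Hypotheses (r0 : 0 < r) (eps01 : 0 < eps <= 1).
Hypothesis K_off : forall z k i, K z -> (i < ring_order k)%N ->
  r * (eps * ring_hole R k) <=
  nm (z - (a + r%:C * ((ring_radius R k)%:C * zeta R (ring_order k) ^+ i))).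

Let w (z : C) : C := (z - a) / r%:C.

Lemma nm_w z : nm (w z) = nm (z - a) / r.
Proof. by rewrite /w nmM nmV nm_real gtr0_norm. Qed.

Lemma off_holes_K z : K z -> off_holes eps (w z).
Proof.
move=> Kz k i ik; have := K_off Kz ik.
have rC : r%:C != 0 :> C by rewrite -nm_gt0 nm_real normr_gt0 gt_eqF.
set v := _ * zeta R _ ^+ i.
have -> : z - (a + r%:C * v) = r%:C * (w z - v) by rewrite /w; field.
by rewrite nmM nm_real gtr0_norm // ler_pM2l.
Qed.

Lemma ring_prod_rational n : exists p q : {poly C},
  (forall z, K z -> q.[z] != 0) /\
  (forall z, K z -> ring_prod n (w z) = p.[z] / q.[z]).
Proof.
have eps0 : 0 < eps by case/andP: eps01.
have rC : r%:C != 0 :> C by rewrite -nm_gt0 nm_real normr_gt0 gt_eqF.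
elim: n => [|n [p [q [qK pq]]]].
  exists 1, 1; split=> z _; first by rewrite hornerC oner_eq0.
  by rewrite /ring_prod big_ord0 hornerC divr1.
pose N := ring_order n; pose rho : C := (ring_radius R n)%:C.
pose W : {poly C} := r%:C^-1 *: ('X - a%:P).
have WE z : W.[z] = w z by rewrite /W !hornerE mulrC.
exists (p * W ^+ N), (q * (W ^+ N - (rho ^+ N)%:P)); split=> z Kz.
  rewrite hornerM mulf_neq0 ?qK // hornerD hornerN hornerC horner_exp WE.
  exact: off_holes_neq0 (off_holes_K Kz).
rewrite /ring_prod big_ord_recr -/(ring_prod n _) pq // /ring_factor !hornerM.
by rewrite hornerD hornerN hornerC horner_exp WE invfM mulrACA.
Qed.

(** [H] is the limit of [ring_prod n], uniform on [K] by the geometric rate; the estimates for the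
    products pass to the limit. It vanishes for |w| <= 1 because this disc lies inside all rings. *)
Lemma barrier : exists H : K -> C^o, [/\ RK K H,
  forall z, nm ((set_val z : C) - a) <= r -> H z = 0,
  forall z, nm (H z : C) <= 2 ^+ 11 / eps &
  forall z, 2 * r <= nm ((set_val z : C) - a) ->
    nm (H z - 1 : C) <= r / nm ((set_val z : C) - a)].
Proof.
have eps0 : 0 < eps by case/andP: eps01.
pose B := 2 ^+ 11 / eps.
have B0 : 0 < B by rewrite divr_gt0 ?exprn_gt0.
have lim (z : K) : exists l : C, forall n,
    nm (l - ring_prod n (w (set_val z))) <= 4 * B * (2 ^+ n)^-1.
  apply: geometric_limitC => n.
  by apply: ring_prod_step => //; apply: off_holes_K; exact: set_val_in.
pose H (z : K) : C^o := projT1 (cid (lim z)).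
have HP z n : nm ((H z : C) - ring_prod n (w (set_val z))) <= 4 * B * (2 ^+ n)^-1.
  exact: (projT2 (cid (lim z))).
have H_le (z : K) (c : C) (y : R) :
    (forall n, nm (ring_prod n (w (set_val z)) - c) <= y) -> nm (H z - c : C) <= y.
  move=> h; apply: (@le_geometric R _ _ (4 * B)) => n.
  apply: le_trans (nm_dist _ (ring_prod n (w (set_val z))) _) _.
  by have := HP z n; have := h n; lra.
exists H; split.
- apply/RK_approx => e e0.
  have B4 : 0 < 4 * B by rewrite mulr_gt0.
  have eB : 0 < e / 2 / (4 * B) by rewrite divr_gt0 ?divr_gt0.
  have [|n /(_ n (leqnn _))] := @expr_small R 2^-1 _ _ eB.
    by rewrite invr_ge0 ler0n invf_lt1 // ltr1n.
  rewrite exprVn ler_pdivlMr // mulrC => hn.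
  have [p [q [qK pq]]] := ring_prod_rational n.
  exists p, q; split=> // z; rewrite -pq; last exact: set_val_in.
  by have := HP z n; lra.
- move=> z za; apply/eqP; rewrite -(nm_eq0 (H z : C)) eq_le nm_ge0 andbT.
  apply: (@le_geometric R _ _ (4 * B + 1)) => n; rewrite add0r.
  rewrite -[X in nm X](subrK (ring_prod n (w (set_val z)))).
  apply: le_trans (nmD _ _) _.
  have h : nm (ring_prod n (w (set_val z))) <= (2 ^+ n)^-1.
    apply: le_trans (ring_prod_inside _) _; last by rewrite inv2X_le //; lia.
    rewrite nm_w; apply: le_trans (ltW (theta_gt1 _ _)).
    by rewrite ler_pdivrMr // mul1r.
  by have := HP z n; lra.
- move=> z; rewrite -[X in nm X]subr0; apply: H_le => n; rewrite subr0.
  by apply: ring_prod_bound' => //; apply: off_holes_K; exact: set_val_in.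
- move=> z za; apply: H_le => n.
  have w2 : 2 <= nm (w (set_val z)) by rewrite nm_w ler_pdivlMr.
  apply: le_trans (ring_prod_outside n w2) _.
  rewrite nm_w invf_div mulrC ler_piMr //.
    by rewrite divr_ge0 ?nm_ge0 // ltW.
  by rewrite gerBl ltW // inv2X_gt0.
Qed.

End Barrier.

(** * Barriers and holes in one disc *)

Section BoundedSums.
Variable R : realType.

(** For nonnegative [f], says that the unordered sum over all of [T] is at most [A]. *)
Definition sums_le (T : eqType) (f : T -> R) (A : R) :=
  forall s : seq T, uniq s -> \sum_(x <- s) f x <= A.

Lemma ler_sum_subset (T : eqType) (s t : seq T) (f : T -> R) :
  uniq s -> uniq t -> {subset s <= t} -> (forall x, 0 <= f x) ->
  \sum_(x <- s) f x <= \sum_(x <- t) f x.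
Proof.
move=> us ut st f0; rewrite [leRHS](bigID (fun x => x \in s)) /=.
have -> : \sum_(x <- s) f x = \sum_(x <- t | x \in s) f x.
  rewrite -[RHS]big_filter (perm_big [seq x <- t | x \in s]) //.
  apply: uniq_perm; rewrite ?filter_uniq // => x.
  by rewrite mem_filter; case: (boolP (x \in s)) => // /st ->.
by rewrite lerDl sumr_ge0.
Qed.

(** Tonelli for unordered sums: a finite set of pairs is grouped by first components. *)
Lemma sums_le_pair (T1 T2 : eqType) (F : T1 * T2 -> R) (G : T1 -> R) (A : R) :
  (forall x, 0 <= F x) -> (forall x, sums_le (fun y => F (x, y)) (G x)) ->
  sums_le G A -> sums_le F A.
Proof.
move=> F0 FG GA s us; pose t := undup (unzip1 s).
have ut : uniq t by exact: undup_uniq.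
have -> : \sum_(z <- s) F z =
    \sum_(x <- t) \sum_(z <- s | z.1 == x) F (x, z.2).
  have E z : z \in s -> F z = \sum_(x <- t) (if z.1 == x then F (x, z.2) else 0).
    move=> zs; have zt : z.1 \in t by rewrite mem_undup map_f.
    rewrite (bigD1_seq z.1) //= eqxx big1 ?addr0; first by case: (z).
    by move=> x; rewrite eq_sym => /negbTE ->.
  rewrite big_seq (eq_bigr _ E) -big_seq exchange_big /=.
  by apply: eq_bigr => x _; rewrite [RHS]big_mkcond.
apply: le_trans (GA _ ut); apply: ler_sum => x _.
have -> : \sum_(z <- s | z.1 == x) F (x, z.2) =
    \sum_(y <- [seq z.2 | z <- s & z.1 == x]) F (x, y).
  by rewrite big_map big_filter.
apply: FG; rewrite map_inj_in_uniq ?filter_uniq // => -[a b] [c d].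
by rewrite !mem_filter /= => /andP[/eqP -> _] /andP[/eqP -> _] ->.
Qed.

(** Equal to 1/(k+1) - 1/(k+2), so the total is 1. *)
Definition weight (k : nat) : R := ((k.+1 * k.+2)%N%:R)^-1.

Lemma weight_gt0 k : 0 < weight k.
Proof. by rewrite invr_gt0 ltr0n. Qed.

Lemma weight_le_half k : weight k <= 2^-1.
Proof. by rewrite lef_pV2 ?posrE ?ltr0n // ler_nat; nia. Qed.

Lemma sum_weight n : \sum_(k < n) weight k = 1 - (n.+1%:R)^-1.
Proof.
elim: n => [|n IH]; first by rewrite big_ord0 invr1 subrr.
rewrite big_ord_recr /= IH /weight natrM.
have -> : n.+2%:R = n.+1%:R + 1 :> R by rewrite -natr1.
have n0 : n.+1%:R != 0 :> R by rewrite pnatr_eq0.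
have n1 : n.+1%:R + 1 != 0 :> R by rewrite natr1 pnatr_eq0.
by move: n.+1%:R n0 n1 {IH} => x n0 n1; field; rewrite ?n0 ?n1.
Qed.

Lemma sums_le_weight : sums_le weight 1.
Proof.
move=> s us; pose n := (\max_(x <- s) x).+1.
apply: (@le_trans _ _ (\sum_(x <- iota 0 n) weight x)).
  apply: ler_sum_subset => //; first exact: iota_uniq.
    by move=> x xs; rewrite mem_iota /= add0n ltnS; apply: leq_bigmax_seq.
  by move=> x; exact: ltW (weight_gt0 x).
rewrite -[iota 0 n]/(index_iota 0 n) big_mkord sum_weight gerBl invr_ge0.
exact: ler0n.
Qed.

Lemma sums_le_const (N : nat) (c : R) : 0 <= c ->
  sums_le (fun t => if (t < N)%N then c / N%:R else 0) c.
Proof.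
move=> c0 s us; rewrite -big_mkcond -big_filter big_const_seq count_predT.
rewrite iter_addr_0 -[X in X <= _]mulr_natr.
have : (size [seq t <- s | (t < N)%N] <= N)%N.
  rewrite -[leqRHS](size_iota 0); apply: uniq_leq_size; first exact: filter_uniq.
  by move=> t; rewrite mem_filter mem_iota => /andP[].
set k := size _; case: N @k => [|N] k; first by rewrite leqn0 => /eqP ->; rewrite mulr0.
move=> sN; rewrite mulrAC ler_pdivrMr ?ltr0n // ler_wpM2l // ler_nat //.
Qed.

Lemma sums_leZ (T : eqType) (f : T -> R) (A c : R) : 0 <= c ->
  sums_le f A -> sums_le (fun x => c * f x) (c * A).
Proof. by move=> c0 fA s us; rewrite -mulr_sumr ler_wpM2l // fA. Qed.

End BoundedSums.

(** * Position, size and total weight of the holes around one centre *)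

Section Holes.
Variable R : realType.
Local Notation C := R[i].
Variables (p : C) (s : R) (d : nat).
Hypotheses (s0 : 0 < s) (s2 : s <= 4^-1).

Local Notation wt := (weight R).
Local Notation barrier_index := (nat * nat * nat)%type.
Local Notation ring_index := (nat * nat)%type.
Implicit Types (b : barrier_index) (h : ring_index).

(* The barriers of scale [n] are indexed by [(n, k, l)], where [(n, 0, 0)] is
   centred at [p] and the others at the points of a square grid of mesh half
   their radius, with [k] and [l] shifted so as to cover both signs. *)
Definition barrier_radius b : R := s / b.1.1.+2%:R ^+ 3.

Definition central b : bool := (b.1.2 == 0%N) && (b.2 == 0%N).

(** The mesh is s / (2 (n+2)^3), so 2 (n+2)^3 steps span the radius [s]. *)
Definition lattice_shift b : nat := (2 * b.1.1.+2 ^ 3).+1.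

Definition barrier_center b : C :=
  if central b then p else
  p + (barrier_radius b / 2)%:C *
      ((b.1.2%:R - (lattice_shift b)%:R) +i* (b.2%:R - (lattice_shift b)%:R)).

(* The strength of a barrier is its distance to [p] raised to the power at
   which functions on the set are to remain differentiable at [p]. *)
Definition barrier_strength b : R :=
  if central b then 64^-1 * wt b.1.1 * barrier_radius b ^+ d
  else 64^-1 * (nm (barrier_center b - p) / 2) ^+ d.+1 * wt b.1.1 * wt b.1.2 * wt b.2.

(** The first inequality keeps the holes, which are within 2 radii of the barrier centre, at a
    distance from [p] comparable to that of the centre; the second keeps them within 2 s of [p]. *)
Definition valid b : bool := central b ||
  (4 * barrier_radius b <= nm (barrier_center b - p)) &&
  (nm (barrier_center b - p) + 2 * barrier_radius b <= 2 * s).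

Definition hole_center b h : C :=
  barrier_center b + (barrier_radius b)%:C *
    ((ring_radius R h.1)%:C * zeta R (ring_order h.1) ^+ h.2).

Definition hole_radius b h : R :=
  barrier_radius b * (barrier_strength b * ring_hole R h.1).

Lemma barrier_radius_gt0 b : 0 < barrier_radius b.
Proof. by rewrite divr_gt0 // exprn_gt0 // ltr0n. Qed.

Lemma barrier_radius_le b : barrier_radius b <= s / 8.
Proof.
rewrite ler_wpM2l ?(ltW s0) // lef_pV2 ?posrE ?exprn_gt0 ?ltr0n // -natrX ler_nat.
by apply: (@leq_trans (2 ^ 3)%N); rewrite ?leq_exp2r.
Qed.

Lemma valid_radius b : valid b -> nm (barrier_center b - p) + 2 * barrier_radius b <= 2 * s.
Proof.
case/orP => [cb|/andP[_ //]]; rewrite /barrier_center cb subrr nm0 add0r.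
by have := barrier_radius_le b; have := s0; lra.
Qed.

Lemma barrier_strength_gt0 b : valid b -> 0 < barrier_strength b.
Proof.
rewrite /valid /barrier_strength; case: ifP => cb /=.
  by rewrite !mulr_gt0 ?invr_gt0 ?weight_gt0 ?exprn_gt0 ?barrier_radius_gt0.
move=> /andP[h _]; rewrite !mulr_gt0 ?invr_gt0 ?weight_gt0 ?exprn_gt0 ?divr_gt0 //.
by apply: lt_le_trans h; rewrite mulr_gt0 // barrier_radius_gt0.
Qed.

Lemma barrier_strength_le b : valid b -> barrier_strength b <= 64^-1.
Proof.
move=> vb; have r0 := barrier_radius_gt0 b; have rs := barrier_radius_le b.
have vr := valid_radius vb.
have w1 k : 0 <= wt k <= 1.
  by rewrite ltW ?weight_gt0 //; have := weight_le_half R k; lra.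
rewrite /barrier_strength; case: ifP => cb.
  have /andP[a1 a2] := w1 b.1.1; rewrite -mulrA ler_piMr ?invr_ge0 //.
  apply: mulr_ile1; rewrite ?exprn_ge0 ?exprn_ile1 ?(ltW r0) //.
  by have := s2; lra.
have x0 := nm_ge0 (barrier_center b - p).
have x2 : nm (barrier_center b - p) / 2 <= 1 by have := s2; lra.
have x2' : 0 <= nm (barrier_center b - p) / 2 by rewrite divr_ge0.
rewrite -!mulrA ler_piMr ?invr_ge0 //.
have /andP[a1 a2] := w1 b.1.1; have /andP[a3 a4] := w1 b.1.2; have /andP[a5 a6] := w1 b.2.
by rewrite !mulr_ile1 ?mulr_ge0 ?exprn_ge0 ?divr_ge0 ?exprn_ile1.
Qed.

Lemma ring_radius_bounds k : 1 < ring_radius R k <= 3 / 2.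
Proof.
rewrite theta_gt1 /=; apply: le_trans (theta_anti R (ltn0Sn _)) _.
by rewrite /theta expr1; lra.
Qed.

Lemma hole_offset b h : nm (hole_center b h - barrier_center b) =
  barrier_radius b * ring_radius R h.1.
Proof.
have /andP[r1 _] := ring_radius_bounds h.1.
rewrite /hole_center addrC addKr !nmM nmX nm_zeta ?ring_order_gt0 // expr1n mulr1.
by rewrite !nm_real !gtr0_norm ?barrier_radius_gt0 //; lra.
Qed.

Lemma hole_radius_gt0 b h : valid b -> 0 < hole_radius b h.
Proof.
move=> vb; apply: mulr_gt0; first exact: barrier_radius_gt0.
by apply: mulr_gt0; [exact: barrier_strength_gt0 | exact: ring_hole_gt0].
Qed.

Lemma hole_radius_le b h : valid b -> hole_radius b h <= barrier_radius b / 64.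
Proof.
move=> vb; rewrite /hole_radius ler_pM2l ?barrier_radius_gt0 //.
apply: le_trans (barrier_strength_le vb); rewrite ler_piMr ?ring_hole_le1 //.
exact: ltW (barrier_strength_gt0 vb).
Qed.

Lemma hole_near b h (z : C) : valid b -> nm (z - hole_center b h) < hole_radius b h ->
  nm (z - p) < 2 * s.
Proof.
move=> vb zh; have := valid_radius vb; have := hole_radius_le h vb.
have := hole_offset b h; have /andP[_ r2] := ring_radius_bounds h.1.
have r0 := barrier_radius_gt0 b.
have := nm_dist z (hole_center b h) p; have := nm_dist (hole_center b h) (barrier_center b) p.
by nra.
Qed.

(* Every hole of a barrier lies at a distance from [p] comparable to the
   quantity raised to the power [d] or [d.+1] in its strength. *)
Lemma hole_dist b h : valid b -> let D := nm (hole_center b h - p) in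
  [/\ 0 < D, D <= 1 & (if central b then barrier_radius b else nm (barrier_center b - p) / 2) <= D].
Proof.
move=> vb D; have r0 := barrier_radius_gt0 b.
have := hole_offset b h; have /andP[r1 r2] := ring_radius_bounds h.1.
have vr := valid_radius vb => off.
have h1 := nm_dist (hole_center b h) (barrier_center b) p.
have h2 := nm_dist (barrier_center b) (hole_center b h) p.
rewrite (nmC (barrier_center b) (hole_center b h)) in h2.
have D1 : D <= 1 by rewrite /D; have := s2; nra.
have D2 : (if central b then barrier_radius b else nm (barrier_center b - p) / 2) <= D.
  case: ifP => cb.
    have cp : barrier_center b = p by rewrite /barrier_center cb.
    by rewrite cp in off; rewrite /D off; nra.
  by move: vb; rewrite /valid cb /= => /andP[h4 _]; rewrite /D; nra.
split => //; apply: lt_le_trans D2; case: ifP => // cb.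
by move: vb; rewrite /valid cb /= => /andP[h4 _]; rewrite divr_gt0 //; nra.
Qed.

(** A summable majorant over all indices, in product form so that [sums_le_pair] peels off one index
    at a time. *)
Definition hole_weight (bh : barrier_index * ring_index) : R :=
  16^-1 * (wt bh.1.1.1 * wt bh.1.1.2 * wt bh.1.2 *
  (if (bh.2.2 < ring_order bh.2.1)%N then wt bh.2.1 / (ring_order bh.2.1)%:R else 0)).

Lemma hole_radius_weight b h : valid b -> (h.2 < ring_order h.1)%N ->
  hole_radius b h / nm (hole_center b h - p) ^+ d.+1 <= hole_weight (b, h).
Proof.
move=> vb ho; have [D0 D1 DD] := hole_dist h vb; have r0 := barrier_radius_gt0 b.
set D := nm _ in D0 D1 DD *.
have rs := barrier_radius_le b.
rewrite /hole_weight /= ho /hole_radius.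
have -> : ring_hole R h.1 = wt h.1 / (ring_order h.1)%:R.
  by rewrite /ring_hole /wt natrM invfM.
set t := wt h.1 / _; have t0 : 0 <= t by rewrite divr_ge0 ?ler0n // ltW // weight_gt0.
have w0 k : 0 <= wt k by exact: ltW (weight_gt0 _ _).
rewrite ler_pdivrMr ?exprn_gt0 // mulrA.
rewrite [leRHS](_ : _ = (16^-1 * (wt b.1.1 * wt b.1.2 * wt b.2) * D ^+ d.+1) * t); last by ring.
apply: ler_wpM2r => //; move: DD; rewrite /barrier_strength; case: ifP => cb DD.
  have /andP[/eqP -> /eqP ->] := cb.
  (* The two zero indices contribute 1/4, which turns 64^-1 into 16^-1. *)
  have -> : wt 0 = 2^-1 by [].
  have -> : barrier_radius b * (64^-1 * wt b.1.1 * barrier_radius b ^+ d) =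
     16^-1 * (wt b.1.1 / 2 / 2) * barrier_radius b ^+ d.+1 by rewrite exprS; field.
  apply: ler_wpM2l; first by rewrite !mulr_ge0 ?invr_ge0 ?w0.
  by apply: lerXn2r; rewrite ?nnegrE ?(ltW r0) ?(ltW D0).
set W := wt b.1.1 * wt b.1.2 * wt b.2; have W0 : 0 <= W by rewrite !mulr_ge0.
set x := nm (barrier_center b - p) / 2 in DD *.
have x0 : 0 <= x by rewrite divr_ge0 ?nm_ge0.
rewrite [leLHS](_ : _ = barrier_radius b / 64 * (W * x ^+ d.+1)); last by rewrite /W; ring.
have r64 : 0 <= barrier_radius b / 64 by lra.
have r16 : barrier_radius b / 64 <= 16^-1 by have := s2; lra.
rewrite -[leRHS]mulrA; apply: ler_pM => //; first by rewrite mulr_ge0 ?exprn_ge0.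
apply: ler_wpM2l => //.
by apply: lerXn2r; rewrite ?nnegrE ?(ltW D0).
Qed.

Lemma sums_leZ' (T : eqType) (f : T -> R) (c : R) : 0 <= c ->
  sums_le f 1 -> sums_le (fun x => c * f x) c.
Proof. by move=> c0 f1; rewrite -[X in sums_le _ X]mulr1; exact: sums_leZ. Qed.

Lemma sums_le_hole_weight : sums_le hole_weight 16^-1.
Proof.
apply: sums_leZ'; first by rewrite invr_ge0.
have w0 k : 0 <= wt k by exact: ltW (weight_gt0 _ _).
pose g (h : ring_index) : R :=
  if (h.2 < ring_order h.1)%N then wt h.1 / (ring_order h.1)%:R else 0.
have g0 h : 0 <= g h by rewrite /g; case: ifP => // _; rewrite divr_ge0 ?ler0n.
have g1 : sums_le g 1.
  apply: (@sums_le_pair _ _ _ g wt) => //; last exact: sums_le_weight.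
  by move=> i; exact: sums_le_const (ring_order i) _ (w0 i).
apply: (@sums_le_pair _ _ _ _ (fun b : barrier_index => wt b.1.1 * wt b.1.2 * wt b.2)).
- by move=> x; rewrite !mulr_ge0 // g0.
- move=> b; have c0 : 0 <= wt b.1.1 * wt b.1.2 * wt b.2 by rewrite !mulr_ge0.
  exact: (sums_leZ' c0 g1).
apply: (@sums_le_pair _ _ _ _ (fun b : nat * nat => wt b.1 * wt b.2)).
- by move=> x; rewrite !mulr_ge0.
- move=> b; have c0 : 0 <= wt b.1 * wt b.2 by rewrite mulr_ge0.
  exact: (sums_leZ' c0 (@sums_le_weight R)).
apply: (@sums_le_pair _ _ _ _ wt); last exact: sums_le_weight.
- by move=> x; rewrite !mulr_ge0.
- by move=> b; exact: (sums_leZ' (w0 b) (@sums_le_weight R)).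
Qed.

Lemma center_not_in_hole b h : valid b -> (h.2 < ring_order h.1)%N ->
  hole_radius b h <= nm (p - hole_center b h).
Proof.
move=> vb ho; have [D0 D1 DD] := hole_dist h vb; rewrite nmC.
have := hole_radius_le h vb; have r0 := barrier_radius_gt0 b.
move: DD vb; rewrite /valid; case: ifP => cb /=; first by lra.
by move=> h1 /andP[h2 _]; lra.
Qed.

End Holes.

(** * The Swiss cheese *)

Section PlaneTopology.
Variable R : realType.
Local Notation C := R[i].

Lemma closed_nmP (A : set C^o) :
  (forall z : C, ~ A z -> exists2 d : R, 0 < d & forall y, nm (y - z) < d -> ~ A y) ->
  closed A.
Proof.
move=> h; rewrite -openC openE => z Az; apply/nbhs_nmP.
by have [d d0 dA] := h z Az; exists d.
Qed.

Lemma open_disc (c : C) (r : R) : open ([set z | nm (z - c) < r] : set C^o).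
Proof.
rewrite openE => z /= zr; apply/nbhs_nmP; exists (r - nm (z - c)).
  by rewrite subr_gt0.
by move=> y yz; rewrite /=; have := nm_dist y z c; lra.
Qed.

Lemma poly_continuity (P : {poly C}) (z : C) (e : R) : 0 < e ->
  exists2 d : R, 0 < d & forall y, nm (y - z) < d -> nm (P.[y] - P.[z]) < e.
Proof.
move=> e0; have /factor_theorem[Q PQ] : root (P - P.[z]%:P) z.
  by rewrite rootE !hornerE subrr.
have [B B0 QB] := poly_bounded z Q 1.
exists (Num.min 1 (e / B)); first by rewrite lt_min ltr01 divr_gt0.
move=> y; rewrite lt_min => /andP[y1 ye].
have -> : P.[y] - P.[z] = (P - P.[z]%:P).[y] by rewrite !hornerE.
rewrite PQ hornerM hornerXsubC nmM.
rewrite ltr_pdivlMr // in ye; apply: le_lt_trans ye; rewrite mulrC.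
by rewrite ler_wpM2l ?nm_ge0 // QB // ltW.
Qed.

(** An estimate on P / Q with the denominator cleared, so that the set stays closed across the zeros
    of [Q]. *)
Lemma closed_poly_le (P Q : {poly C}) (e : R) : 0 <= e ->
  closed ([set z | e * nm Q.[z] <= nm P.[z]] : set C^o).
Proof.
move=> e0; apply: closed_nmP => z /negP; rewrite -ltNge => h.
pose g := e * nm Q.[z] - nm P.[z].
have g0 : 0 < g by rewrite subr_gt0.
have e1 : 0 < e + 1 by rewrite ltr_wpDl.
have [d1 d10 h1] := poly_continuity P z (divr_gt0 g0 (ltr0n R 2)).
have [d2 d20 h2] := poly_continuity Q z (divr_gt0 (divr_gt0 g0 (ltr0n R 2)) e1).
exists (Num.min d1 d2); first by rewrite lt_min d10.
move=> y; rewrite lt_min => /andP[/h1 y1 /h2]; rewrite ltr_pdivlMr // => y2.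
apply/negP; rewrite -ltNge.
have h3 := nm_dist P.[y] P.[z] 0; have h4 := nm_dist Q.[z] Q.[y] 0.
rewrite (nmC Q.[z] Q.[y]) !subr0 in h3 h4.
have : e * nm Q.[z] <= e * (nm (Q.[y] - Q.[z]) + nm Q.[y]) by rewrite ler_wpM2l.
have h5 := nm_ge0 (Q.[y] - Q.[z]).
by move: y1 y2; rewrite /g; nra.
Qed.

Lemma compact_box : compact ([set z | `|complex.Re z| <= 2 /\ `|complex.Im z| <= 2] : set C^o).
Proof.
pose f (x : R * R) : C^o := x.1 +i* x.2.
have cI := @segment_compact R (-2) 2.
have cII : compact (`[-2, 2]%classic `*` `[-2, 2]%classic : set (R * R)).
  exact: compact_setX.
suff <- : f @` (`[-2, 2]%classic `*` `[-2, 2]%classic) =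
    [set z | `|complex.Re z| <= 2 /\ `|complex.Im z| <= 2].
  apply: continuous_compact cII; apply: continuous_subspaceT => x.
  move=> A /nbhs_nmP[e e0 eA]; have e2 : 0 < e / 2 by rewrite divr_gt0.
  exists (ball x.1 (e / 2), ball x.2 (e / 2)); first by split; exact: nbhsx_ballx.
  move=> y [/= y1 y2]; apply: eA; apply: le_lt_trans (nm_le_re_im _) _.
  move: y1 y2; rewrite -!ball_normE /= => y1 y2.
  by rewrite distrC (distrC y.2) [e]splitr ltrD.
apply/seteqP; split=> [z [[a b] [/= h1 h2] <-]|[a b] [/= h1 h2]] /=.
  by move: h1 h2; rewrite !in_itv /= !ler_norml.
by exists (a, b) => //; split; rewrite /= in_itv /= -ler_norml.
Qed.

Lemma closed_bounded_compact (A : set C^o) : closed A ->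
  (forall z, A z -> nm z <= 2) -> compact A.
Proof.
move=> cA bA; apply: subclosed_compact cA compact_box _ => z /bA z2 /=.
by split; apply: le_trans z2; [exact: nm_re | exact: nm_im].
Qed.

End PlaneTopology.

(** * The set K and its compactness *)

Section SwissCheese.
Variable R : realType.
Local Notation C := R[i].
Implicit Types (z : C) (j : nat) (b : nat * nat * nat) (h : nat * nat).

Definition part_center j : C := ((4 ^+ j)^-1)%:C.
Definition part_radius j : R := (4 ^+ j)^-1 / 8.

Definition hole_index j b h : bool :=
  valid (part_center j) (part_radius j) b && (h.2 < ring_order h.1)%N.

Local Notation hcenter j := (hole_center (part_center j) (part_radius j)).
Local Notation hradius j := (hole_radius (part_center j) (part_radius j) j.+1).

(** Through [hradius], the strength exponent [d] in the [j]-th disc is [j.+1]; this sets the order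
    of regularity at [part_center j]. *)
Definition swiss_cheese : set C^o := [set z : C |
  (z = 0 \/ exists j, nm (z - part_center j) <= part_radius j) /\
  forall j b h, hole_index j b h -> hradius j b h <= nm (z - hcenter j b h)].

Local Notation K := swiss_cheese.

Let q j : R := (4 ^+ j)^-1.

Lemma q_gt0 j : 0 < q j. Proof. by rewrite invr_gt0 exprn_gt0. Qed.

Lemma q_le1 j : q j <= 1.
Proof. by rewrite invf_le1 ?exprn_gt0 // exprn_ege1 ?ler1n. Qed.

Lemma q_lt j k : (j < k)%N -> q k <= q j / 4.
Proof.
move=> jk; rewrite /q -invfM lef_pV2 ?posrE ?mulr_gt0 ?exprn_gt0 // -exprSr.
by rewrite ler_weXn2l ?ler1n.
Qed.

Lemma part_radius_gt0 j : 0 < part_radius j.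
Proof. by rewrite divr_gt0 // q_gt0. Qed.

Lemma part_radius_le j : part_radius j <= 4^-1.
Proof. by have := q_le1 j; rewrite /part_radius -/(q j); lra. Qed.

Lemma nm_part j z (r : R) : nm (z - part_center j) <= r -> q j - r <= nm z <= q j + r.
Proof.
move=> zr; have qE : nm (part_center j) = q j by rewrite nm_real gtr0_norm ?q_gt0.
have := nm_dist z (part_center j) 0; have := nm_dist (part_center j) z 0.
by rewrite (nmC _ z) !subr0 qE => *; apply/andP; split; lra.
Qed.

(** The moduli in the doubled [j]-th disc lie between 3/4 and 5/4 of 4^-j, those in the [k]-th disc
    between 7/8 and 9/8 of 4^-k, and distinct powers differ by a factor at least 4. *)
Lemma part_separated j k z : nm (z - part_center j) < 2 * part_radius j ->
  nm (z - part_center k) <= part_radius k -> j = k.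
Proof.
move=> /ltW /nm_part /andP[j1 j2] /nm_part /andP[k1 k2].
move: j1 j2 k1 k2; rewrite /part_radius -/(q j) -/(q k) => j1 j2 k1 k2.
have qj := q_gt0 j; have qk := q_gt0 k.
have [/q_lt jk|/q_lt jk|//] := ltngtP j k.
  by have : (1 : R) <= 0 by [lra]; rewrite ler10.
by have : (1 : R) <= 0 by [lra]; rewrite ler10.
Qed.

Lemma part_nonzero j z : nm (z - part_center j) < 2 * part_radius j -> z != 0.
Proof.
move=> /ltW /nm_part /andP[h _]; rewrite -nm_gt0; apply: lt_le_trans h.
by rewrite /part_radius -/(q j); have := q_gt0 j; lra.
Qed.

Lemma in_hole_near j b h z : hole_index j b h ->
  nm (z - hcenter j b h) < hradius j b h -> nm (z - part_center j) < 2 * part_radius j.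
Proof.
by move=> /andP[vb _]; apply: hole_near => //; [exact: part_radius_gt0 | exact: part_radius_le].
Qed.

Lemma swiss_cheese0 : K 0.
Proof.
split; first by left.
move=> j b h jbh; rewrite leNgt; apply/negP => /(in_hole_near jbh) /part_nonzero.
by rewrite eqxx.
Qed.

Lemma swiss_cheese_part j z : nm (z - part_center j) <= part_radius j ->
  (forall b h, hole_index j b h -> hradius j b h <= nm (z - hcenter j b h)) -> K z.
Proof.
move=> zj out; split; first by right; exists j.
move=> k b h kbh; rewrite leNgt; apply/negP => zh.
have kj := part_separated (in_hole_near kbh zh) zj.
by move: kbh zh; rewrite kj => /out; rewrite leNgt => /negP.
Qed.

Lemma swiss_cheese_center j : K (part_center j).
Proof.
apply: (@swiss_cheese_part j); first by rewrite subrr nm0 ltW // part_radius_gt0.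
move=> b h /andP[vb ho].
by apply: center_not_in_hole => //; [exact: part_radius_gt0 | exact: part_radius_le].
Qed.

Lemma swiss_cheese_bounded z : K z -> nm z <= 2.
Proof.
move=> [[->|[j /nm_part /andP[_ zj]]] _]; first by rewrite nm0.
by apply: le_trans zj _; rewrite /part_radius -/(q j); have := q_le1 j; lra.
Qed.

Lemma q_small (e : R) : 0 < e -> exists J, q J <= e.
Proof.
move=> e0; have [|J /(_ _ (leqnn _))] := @expr_small R 4^-1 e _ e0.
  by rewrite invr_ge0 ler0n invf_lt1 // ltr1n.
by rewrite exprVn; exists J.
Qed.

Lemma swiss_cheese_closed a : ~ K a ->
  exists2 e : R, 0 < e & forall z, K z -> e <= nm (z - a).
Proof.
move=> Ka; have [[j [b [h [jbh ah]]]]|nohole] :=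
    pselect (exists j b h, hole_index j b h /\ nm (a - hcenter j b h) < hradius j b h).
  exists (hradius j b h - nm (a - hcenter j b h)); first by rewrite subr_gt0.
  by move=> z [_ /(_ _ _ _ jbh)]; have := nm_dist z a (hcenter j b h); lra.
have a0 : a != 0.
  by apply/eqP => a0; apply: Ka; rewrite a0; exact: swiss_cheese0.
have na0 : 0 < nm a by rewrite nm_gt0.
have aj j : part_radius j < nm (a - part_center j).
  rewrite ltNge; apply/negP => aj; apply: Ka; apply: (swiss_cheese_part aj) => b h jbh.
  by rewrite leNgt; apply/negP => ah; apply: nohole; exists j, b, h.
(* From [J] on the discs stay within [nm a / 2] of 0, so only finitely many discs can come near
   [a]. *)
have [J qJ] := q_small (divr_gt0 na0 (ltr0n R 4)).
have [e e0 eP] : exists2 e : R, 0 < e &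
    forall j, (j < J)%N -> e <= nm (a - part_center j) - part_radius j.
  elim: (J) => [|n [e e0 eP]]; first by exists 1.
  exists (Num.min e (nm (a - part_center n) - part_radius n)).
    by rewrite lt_min e0 subr_gt0 aj.
  move=> j; rewrite ltnS leq_eqVlt => /predU1P[->|jn]; first by rewrite ge_min lexx orbT.
  by rewrite ge_min eP.
exists (Num.min e (nm a / 2)); first by rewrite lt_min e0 divr_gt0.
move=> z [[->|[j zj]] _].
  by rewrite sub0r nmN ge_min; apply/orP; right; lra.
rewrite ge_min; have [jJ|Jj] := ltnP j J.
  apply/orP; left; have := eP _ jJ; have := nm_dist a z (part_center j).
  by rewrite (nmC a z); lra.
apply/orP; right; have /andP[_] := nm_part zj; rewrite /part_radius -/(q j) => zq.
have qjJ : q j <= q J.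
  move: Jj; rewrite leq_eqVlt => /predU1P[-> //|/q_lt]; have := q_gt0 J; lra.
by have := nm_dist a z 0; rewrite (nmC a z) !subr0; lra.
Qed.

Lemma compact_plane_set_swiss_cheese : compact_plane_set K.
Proof.
split; first by exists 0; exact: swiss_cheese0.
apply: closed_bounded_compact; last exact: swiss_cheese_bounded.
apply: closed_nmP => a /swiss_cheese_closed[e e0 eK]; exists e => // z za /eK.
by rewrite leNgt za.
Qed.

End SwissCheese.

(** * Cut-off functions *)

Section Cutoffs.
Variable R : realType.
Local Notation C := R[i].
Local Notation K := (@swiss_cheese R).
Implicit Types (z : C) (j : nat) (b : nat * nat * nat).
Local Notation pcenter j := (part_center R j).
Local Notation pradius j := (part_radius R j).
Local Notation bradius j := (barrier_radius (pradius j)).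
Local Notation bcenter j := (barrier_center (pcenter j) (pradius j)).
Local Notation bstrength j := (barrier_strength (pcenter j) (pradius j) j.+1).

Let K_bounded := @swiss_cheese_bounded R.
Let K_closed := @swiss_cheese_closed R.

(** Within 2 r of the barrier centre, |1 - H| is at most 2^12 / eps and |z - x| at most 3 r. Farther
    away one factor z - x is spent against the decay r / |z - a|, giving 2 r, and the other [M]
    factors are at most 4. *)
Lemma cutoff_of_barrier j b (x : K) M (e : R) :
  valid (pcenter j) (pradius j) b ->
  nm ((set_val x : C) - bcenter j b) < bradius j b ->
  2 ^+ 12 / bstrength j b * (3 * bradius j b) ^+ M.+1 <= e ->
  2 * bradius j b * 4 ^+ M <= e ->
  exists2 H, J_ideal (RK K) x H &
    forall z : K, nm ((1 - H z) * ((set_val z : C) - set_val x) ^+ M.+1 : C) <= e.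
Proof.
move=> vb; set a := bcenter j b; set r := bradius j b; set eps := bstrength j b.
move=> xa e1 e2.
have s0 := part_radius_gt0 R j; have s4 := part_radius_le R j.
have r0 : 0 < r := barrier_radius_gt0 s0 b.
have eps0 : 0 < eps := barrier_strength_gt0 j.+1 s0 vb.
have eps1 : eps <= 64^-1 := barrier_strength_le j.+1 s0 s4 vb.
have eps01 : 0 < eps <= 1 by rewrite eps0 /=; lra.
have K_off z k i : K z -> (i < ring_order k)%N -> r * (eps * ring_hole R k) <=
    nm (z - (a + r%:C * ((ring_radius R k)%:C * zeta R (ring_order k) ^+ i))).
  by move=> [_ Kz] ik; apply: (Kz j b (k, i)); rewrite /hole_index vb.
have [H [HK H0 Hb Hfar]] := barrier r0 eps01 K_off.
exists H.
  split=> //; apply/nbhs_subP; exists (r - nm ((set_val x : C) - a)); first by rewrite subr_gt0.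
  by move=> y yx; apply: H0; have := nm_dist (set_val y : C) (set_val x) a; lra.
move=> z; rewrite nmM nmX.
have z2 := K_bounded (set_val_in z); have x2 := K_bounded (set_val_in x).
have hb := Hb z; have hfar := Hfar z.
move: (set_val z : C) (set_val x : C) (H z : C) z2 x2 xa hb hfar => y x' t y2 x2 xa hb hfar.
have h1 := nm_dist y a x'; rewrite (nmC a x') in h1.
have [ya|ya] := leP (2 * r) (nm (y - a)).
  have ya0 : 0 < nm (y - a) by lra.
  apply: le_trans e2; rewrite exprS mulrA.
  have yx4 : nm (y - x') <= 4 by apply: le_trans (nmB _ _) _; lra.
  apply: ler_pM; rewrite ?mulr_ge0 ?exprn_ge0 ?nm_ge0 //.
    have := hfar ya; rewrite (nmC t 1) ler_pdivlMr // => h2.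
    have h3 : nm (1 - t) * nm (y - x') <= nm (1 - t) * (2 * nm (y - a)).
      by apply: ler_wpM2l; [exact: nm_ge0 | lra].
    by have := nm_ge0 (1 - t); nra.
  by apply: lerXn2r; rewrite ?nnegrE ?nm_ge0.
apply: le_trans e1; apply: ler_pM; rewrite ?exprn_ge0 ?nm_ge0 //.
  apply: le_trans (nmB _ _) _; rewrite nm1 exprS.
  have : 1 <= 2 ^+ 11 / eps.
    have h2 : (1 : R) <= 2 ^+ 11 by rewrite exprn_ege1 ?ler1n.
    by rewrite ler_pdivlMr // mul1r; lra.
  by move: hb; set w := 2 ^+ 11 / eps; rewrite -mulrA -/w; lra.
have r3 : 0 <= 3 * r by lra.
have d3 : nm (y - x') <= 3 * r by lra.
by apply: lerXn2r; rewrite ?nnegrE ?nm_ge0.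
Qed.

Lemma small_inverse (e : R) : 0 < e -> exists n, (n.+2%:R)^-1 <= e.
Proof.
move=> e0; exists (Num.bound e^-1).
rewrite -[leRHS]invrK lef_pV2 ?posrE ?invr_gt0 ?ltr0n //.
have := archi_boundP (ltW (divr_gt0 ltr01 e0)); rewrite mul1r => /ltW h.
by apply: le_trans h _; rewrite ler_nat -addn2 leq_addr.
Qed.

Lemma barrier_radius_small j b : bradius j b <= (b.1.1.+2%:R)^-1 / 8.
Proof.
rewrite /barrier_radius; set q := b.1.1.+2%:R.
have q2 : 2 <= q by rewrite ler_nat.
have q0 : 0 < q by lra.
have qV : q^-1 <= 2^-1 by rewrite lef_pV2 ?posrE.
have qV0 : 0 < q^-1 by rewrite invr_gt0.
have s0 := part_radius_gt0 R j; have s4 := part_radius_le R j.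
rewrite -exprVn; set y := q^-1 in qV qV0 *.
have y2 : y ^+ 2 <= 4^-1 by rewrite expr2; nra.
have y20 : 0 <= y ^+ 2 by rewrite exprn_ge0 // ltW.
rewrite exprS; set t := y ^+ 2 in y2 y20 *.
have : pradius j * t <= 16^-1 by nra.
by nra.
Qed.

(** For the central barrier of scale [n], r^(j+2) / eps is a constant times r / weight n. The cube
    in [barrier_radius] beats the two powers of [n] in the weight and leaves O(1 / n). *)
Lemma power_in_closure_center j (x : K) : set_val x = pcenter j ->
  power_in_closure (RK K) x j.+2.
Proof.
move=> xj; apply: (power_in_closure_cutoff K_bounded K_closed) => e e0.
pose A : R := 2 ^+ 12 * 64 * 3 ^+ j.+2 + 2 * 4 ^+ j.+1.
have pw (u : R) i : 0 < u -> 0 < u ^+ i by move=> u0; rewrite exprn_gt0.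
have A1 : 0 < 2 ^+ 12 * 64 * 3 ^+ j.+2 :> R.
  exact: mulr_gt0 (mulr_gt0 (pw 2 12 (ltr0n R 2)) (ltr0n R 64)) (pw 3 _ (ltr0n R 3)).
have A2 : 0 < 2 * 4 ^+ j.+1 :> R by exact: mulr_gt0 (ltr0n R 2) (pw 4 _ (ltr0n R 4)).
have A0 : 0 < A by rewrite addr_gt0.
have [n] := small_inverse (divr_gt0 e0 A0); rewrite ler_pdivlMr // => nA.
pose b := (n, 0%N, 0%N).
have s0 := part_radius_gt0 R j; have s4 := part_radius_le R j.
have r0 := barrier_radius_gt0 s0 b.
have rs := barrier_radius_small j b; rewrite /= in rs.
have cb : bcenter j b = pcenter j by [].
have y0 : 0 < (n.+2%:R : R)^-1 by rewrite invr_gt0 ltr0n.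
apply: (@cutoff_of_barrier j b) => //.
- by rewrite cb -xj subrr nm0.
- have -> : 2 ^+ 12 / bstrength j b * (3 * bradius j b) ^+ j.+2 =
     2 ^+ 12 * 64 * 3 ^+ j.+2 * (bradius j b / weight R n).
    have -> : bstrength j b = 64^-1 * weight R n * bradius j b ^+ j.+1 by [].
    move: (bradius j b) r0 {rs} => r r0; rewrite exprMn (exprS r j.+1) (exprS r j).
    by field; rewrite !gt_eqF ?weight_gt0 ?exprn_gt0.
  apply: le_trans nA; rewrite mulrC; apply: ler_pM; rewrite ?(ltW A1) //.
  + by rewrite divr_ge0 ?ltW ?weight_gt0.
  + rewrite /weight invrK /barrier_radius /= natrM.
    have -> : pradius j / n.+2%:R ^+ 3 * (n.+1%:R * n.+2%:R) =
       pradius j * (n.+1%:R / n.+2%:R) * n.+2%:R^-1.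
      have : n.+2%:R != 0 :> R by rewrite pnatr_eq0.
      by move: (n.+1%:R : R) (n.+2%:R : R) => u v v0; field.
    have v0 : 0 <= n.+1%:R / n.+2%:R :> R by rewrite divr_ge0 ?ler0n.
    have v1 : n.+1%:R / n.+2%:R <= 1 :> R.
      by rewrite ler_pdivrMr ?ltr0n // mul1r ler_nat.
    by apply: ler_piMl (ltW y0) _; apply: mulr_ile1 (ltW s0) v0 _ v1; lra.
  + by rewrite /A lerDl ltW.
- apply: le_trans nA; rewrite mulrAC mulrC.
  have B : bradius j b <= n.+2%:R^-1.
    by move: (bradius j b) (_^-1 : R) rs y0 => u v; lra.
  have A3 : 2 * 4 ^+ j.+1 <= A by rewrite /A lerDr ltW.
  exact: ler_pM (ltW r0) (ltW A2) B A3.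
Qed.

(* The shift by [m.+1] keeps the index positive: an index [0] would designate
   the central barrier. *)
Lemma grid_near (u r : R) (m : nat) : 0 < r -> `|u| <= r / 2 * m%:R ->
  exists k : nat, [/\ (0 < k)%N, (k <= m + m.+1)%N &
    `|u - r / 2 * (k%:R - m.+1%:R)| < r / 2].
Proof.
move=> r0; have r2 : 0 < r / 2 by rewrite divr_gt0.
rewrite mulrC -ler_pdivrMr // -[r / 2 in X in X -> _]gtr0_norm // -normf_div.
have uE : u = r / 2 * (u / (r / 2)) by rewrite mulrC divfK ?gt_eqF.
set y := u / (r / 2) in uE *; rewrite ler_norml => /andP[y1 y2].
have m1 : m.+1%:R = m%:R + 1 :> R by rewrite -natr1.
have y0 : 0 <= y + m.+1%:R by rewrite m1; lra.
have /andP[h1 h2] := truncn_itv y0; set k := Num.truncn _ in h1 h2.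
exists k; split.
- have : ~~ (y + m.+1%:R < 1) by rewrite -leNgt m1; lra.
  by case: (k) h2 => // h2; rewrite h2.
- by rewrite -(ler_nat R) natrD; lra.
- rewrite -natr1 in h2; rewrite ltr_norml uE -mulrBr.
  by apply/andP; split; nra.
Qed.

Lemma nm_sub_grid (w : C) (t c d : R) :
  nm (w - t%:C * (c +i* d)) <= `|complex.Re w - t * c| + `|complex.Im w - t * d|.
Proof.
by apply: le_trans (nm_le_re_im _) _; case: w => a b /=; rewrite !mul0r addr0 subr0.
Qed.

Lemma weightV_le (k m : nat) : (k <= m + m.+1)%N -> (8 <= m)%N ->
  (weight R k)^-1 <= (3 * m%:R) ^+ 2.
Proof.
move=> km m8; rewrite /weight invrK -natrM -natrX ler_nat expnS expn1.
by apply: leq_mul; lia.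
Qed.

(** The grid has about n^3 points per direction, so 1 / eps is O(n^2) from the scale weight times
    O(n^12) from the two grid weights. As r is O(n^-3), the power 5 gives r^5 / eps = O(1 / n). *)
Lemma power_in_closure_generic j (x : K) :
  nm ((set_val x : C) - pcenter j) <= pradius j -> set_val x <> pcenter j ->
  power_in_closure (RK K) x 5.
Proof.
move=> xs xp; apply: (power_in_closure_cutoff K_bounded K_closed) => e e0.
have s0 := part_radius_gt0 R j; have s4 := part_radius_le R j.
pose D := nm ((set_val x : C) - pcenter j).
have D0 : 0 < D by rewrite nm_gt0 subr_eq0; apply/eqP.
pose A1 : R := 2 ^+ 12 * 64 * (4 / D) ^+ j.+2 * 6 ^+ 4 * 3 ^+ 5.
have pw (u : R) i : 0 < u -> 0 < u ^+ i by move=> u0; rewrite exprn_gt0.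
have D4 : 0 < 4 / D by rewrite divr_gt0.
have A10 : 0 < A1.
  exact: mulr_gt0 (mulr_gt0 (mulr_gt0 (mulr_gt0 (pw 2 12 (ltr0n R 2)) (ltr0n R 64))
    (pw _ _ D4)) (pw 6 4 (ltr0n R 6))) (pw 3 5 (ltr0n R 3)).
have A20 : 0 < 2 * 4 ^+ 4 :> R by exact: mulr_gt0 (ltr0n R 2) (pw 4 4 (ltr0n R 4)).
pose A : R := A1 + 2 * 4 ^+ 4.
have A0 : 0 < A by exact: addr_gt0.
(* The bound [D / 10] makes [r] small compared with [D]: the chosen barrier is then valid and its
   centre is at a distance from [p_j] comparable to [D]. *)
have [|n] := @small_inverse (Num.min (D / 10) (e / A)).
  by rewrite lt_min !divr_gt0.
rewrite le_min !ler_pdivlMr // => /andP[nD nA].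
pose m := (2 * n.+2 ^ 3)%N.
have m8 : (8 <= m)%N.
  by apply: (@leq_trans (2 * 2 ^ 3)%N); rewrite // leq_mul2l leq_exp2r.
pose y : R := n.+2%:R^-1.
rewrite -/y in nD nA.
have y0 : 0 < y by rewrite invr_gt0 ltr0n.
pose r : R := pradius j / n.+2%:R ^+ 3.
have r0 : 0 < r by rewrite divr_gt0 ?exprn_gt0 ?ltr0n.
have rE : r / 2 * m%:R = pradius j.
  rewrite /r /m natrM natrX; field.
  by have n0 := ler0n R n; rewrite gt_eqF //; lra.
have ry : r <= y / 8 by exact: (barrier_radius_small j (n, 0%N, 0%N)).
have [|k [k0 km ku]] := @grid_near (complex.Re ((set_val x : C) - pcenter j)) r m r0.
  by rewrite rE; apply: le_trans xs; exact: nm_re.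
have [|l [l0 lm lv]] := @grid_near (complex.Im ((set_val x : C) - pcenter j)) r m r0.
  by rewrite rE; apply: le_trans xs; exact: nm_im.
pose b := (n, k, l).
have ncb : central b = false by rewrite /central /= eqn0Ngt k0.
have xa : nm ((set_val x : C) - bcenter j b) < r.
  rewrite /barrier_center ncb opprD addrA.
  apply: le_lt_trans (nm_sub_grid _ _ _ _) _.
  by rewrite [r in X in _ < X]splitr; apply: ltrD; [exact: ku | exact: lv].
have rb : bradius j b = r by [].
have aD := nm_dist (set_val x : C) (bcenter j b) (pcenter j).
have aD' := nm_dist (bcenter j b) (set_val x : C) (pcenter j).
rewrite (nmC (bcenter j b) (set_val x)) in aD'; rewrite -/D in aD aD'.
have vb : valid (pcenter j) (pradius j) b.
  rewrite /valid ncb rb /=; apply/andP; split; first by lra.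
  have : r <= pradius j / 8 by exact: (barrier_radius_le s0 b).
  by move: xs; rewrite -/D; lra.
apply: (@cutoff_of_barrier j b) => //; rewrite rb; last first.
  apply: le_trans nA; rewrite mulrAC mulrC; apply: ler_pM.
  - exact: ltW.
  - exact: ltW.
  - by rewrite -/y; lra.
  - by rewrite /A lerDr ltW.
apply: (@le_trans _ _ (A1 * y)); last first.
  apply: le_trans nA; rewrite mulrC; apply: ler_wpM2l; first exact: ltW.
  by rewrite /A lerDl ltW.
have eps0 := barrier_strength_gt0 j.+1 s0 vb.
have wV i : 0 <= (weight R i)^-1 by rewrite invr_ge0 ltW ?weight_gt0.
have epsV : (bstrength j b)^-1 <= 64 * (4 / D) ^+ j.+2 * (3 * m%:R) ^+ 2 ^+ 2 * n.+2%:R ^+ 2.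
  pose X := nm (bcenter j b - pcenter j) / 2.
  have XD : D / 4 <= X by rewrite /X; lra.
  have X0 : 0 < X by lra.
  have -> : bstrength j b = 64^-1 * X ^+ j.+2 * weight R n * weight R k * weight R l.
    by rewrite /barrier_strength ncb.
  have inv5 (u1 u2 u3 u4 u5 : R) : (u1^-1 * u2 * u3 * u4 * u5)^-1 =
      u1 * u2^-1 * u3^-1 * u4^-1 * u5^-1 by rewrite !invfM invrK.
  have le5 (u1 u2 u3 u4 u5 v2 v3 v4 v5 : R) : 0 <= u1 -> 0 <= u2 -> 0 <= u3 ->
      0 <= u4 -> 0 <= u5 -> u2 <= v2 -> u3 <= v3 -> u4 <= v4 -> u5 <= v5 ->
      u1 * u2 * u3 * u4 * u5 <= u1 * v2 * v3 * v4 * v5.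
    move=> *; apply: ler_pM; rewrite ?mulr_ge0 //; apply: ler_pM; rewrite ?mulr_ge0 //.
    by apply: ler_pM; rewrite ?mulr_ge0 //; exact: ler_wpM2l.
  have comm5 (u1 u2 u3 u4 : R) : u1 * u2 * u3 ^+ 2 * u4 = u1 * u2 * u4 * u3 * u3 by ring.
  rewrite inv5 comm5; apply: le5 => //.
  - by rewrite invr_ge0 exprn_ge0 // ltW.
  - rewrite -exprVn; apply: lerXn2r; rewrite ?nnegrE ?invr_ge0 ?(ltW X0) ?(ltW D4) //.
    by rewrite -[4 / D]invf_div lef_pV2 // posrE // divr_gt0.
  - by rewrite /weight invrK -natrX ler_nat expnS expn1 leq_mul.
  - exact: weightV_le.
  - exact: weightV_le.
apply: (@le_trans _ _ (2 ^+ 12 *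
    (64 * (4 / D) ^+ j.+2 * (3 * m%:R) ^+ 2 ^+ 2 * n.+2%:R ^+ 2) * (3 * r) ^+ 5)).
  have r30 : 0 <= 3 * r by lra.
  apply: ler_wpM2r; first exact: exprn_ge0.
  by apply: ler_wpM2l; [exact: ltW (pw 2 12 (ltr0n R 2)) | exact: epsV].
have r3 : r <= y ^+ 3.
  by rewrite /y exprVn /r ler_piMl ?invr_ge0 ?exprn_ge0 ?ler0n //; lra.
have mE : m%:R = 2 * n.+2%:R ^+ 3 :> R by rewrite /m natrM natrX.
rewrite mE (exprMn 5) /A1.
have yV : n.+2%:R = y^-1 by rewrite /y invrK.
apply: (@le_trans _ _ (2 ^+ 12 *
    (64 * (4 / D) ^+ j.+2 * (3 * (2 * n.+2%:R ^+ 3)) ^+ 2 ^+ 2 * n.+2%:R ^+ 2) *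
    (3 ^+ 5 * (y ^+ 3) ^+ 5))).
  have c0 (u v w : R) i : 0 < u -> 0 < v -> 0 < w -> 0 <= 2 ^+ i * (64 * u * v * w).
    move=> u0 v0 w0.
    exact: ltW (mulr_gt0 (pw 2 i (ltr0n R 2))
      (mulr_gt0 (mulr_gt0 (mulr_gt0 (ltr0n R 64) u0) v0) w0)).
  have n0 : 0 < n.+2%:R :> R by rewrite ltr0n.
  have f0 : 0 < 3 * (2 * n.+2%:R ^+ 3) :> R.
    exact: mulr_gt0 (ltr0n R 3) (mulr_gt0 (ltr0n R 2) (pw _ 3 n0)).
  apply: ler_wpM2l; first exact: c0 (pw _ _ D4) (pw _ 2 (pw _ 2 f0)) (pw _ 2 n0).
  apply: ler_wpM2l; first exact: ltW (pw 3 5 (ltr0n R 3)).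
  apply: lerXn2r => //; first exact: ltW.
  exact: ltW (pw _ 3 y0).
rewrite yV; set X := (4 / D) ^+ j.+2; set T := 2 ^+ 12; set U := 3 ^+ 5.
by rewrite le_eqVlt; apply/orP; left; apply/eqP; field; rewrite gt_eqF.
Qed.

(** The circle of radius [rho] lies in a gap between consecutive discs, so the indicator of |z| >=
    rho on [K] is the uniform limit of z^N / (z^N - rho^N). *)
Lemma power_in_closure_zero (x : K) : set_val x = 0 -> power_in_closure (RK K) x 1.
Proof.
move=> x0; apply: (power_in_closure_cutoff K_bounded K_closed) => e e0.
have [J qJ] := q_small e0; set q := (4 ^+ J)^-1 in qJ.
have q0 : 0 < q by exact: q_gt0.
pose rho := q / 2.
have rho0 : 0 < rho by rewrite divr_gt0.
have gap z : K z -> nm z <= 9 / 16 * rho \/ 7 / 4 * rho <= nm z.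
  move=> [[->|[j zj]] _]; first by left; rewrite nm0; lra.
  have := nm_part zj; rewrite /part_radius; set qj := (4 ^+ j)^-1 => /andP[z1 z2].
  have [jJ|Jj] := leqP j J.
    right; have : q <= qj by rewrite lef_pV2 ?posrE ?exprn_gt0 // ler_weXn2l ?ler1n.
    by rewrite /rho; lra.
  by left; have := q_lt R Jj; rewrite -/q -/qj /rho; lra.
pose H (z : K) : C^o := if rho <= nm (set_val z : C) then 1 else 0.
exists H; last first.
  move=> z; rewrite x0 subr0 expr1.
  have -> : (1 - H z : C) = if rho <= nm (set_val z : C) then 0 else 1.
    by rewrite /H; case: ifP => _; [exact: subrr | exact: subr0].
  case: (leP rho (nm (set_val z : C))) => zr; first by rewrite mul0r nm0 ltW.
  by rewrite mul1r; move: zr; rewrite /rho; lra.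
split; last first.
  apply/nbhs_subP; exists rho => // y; rewrite x0 subr0 /= /H => yr.
  by rewrite leNgt yr.
have rhoC : rho%:C != 0 :> C by rewrite -nm_gt0 nm_real normr_gt0 gt_eqF.
apply/RK_approx => d d0.
have d1 : 0 < Num.min (2^-1) (d / 3) by rewrite lt_min invr_gt0 ltr0n divr_gt0.
have [|N /(_ _ (leqnn _)) hN] := @expr_small R (3 / 4) _ _ d1.
  by apply/andP; split; lra.
move: hN; rewrite le_min => /andP[hN1 hN2].
exists ('X^(N.+1)), ('X^(N.+1) - (rho%:C ^+ N.+1)%:P).
have hS : (3 / 4) ^+ N.+1 <= (3 / 4) ^+ N :> R by rewrite ler_wiXn2l //; lra.
have vsmall (v : C) : nm v <= 3 / 4 -> nm (v ^+ N.+1 / (1 - v ^+ N.+1)) < d /\ v ^+ N.+1 != 1.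
  move=> v34; have vN : nm (v ^+ N.+1) <= (3 / 4) ^+ N.+1.
    by rewrite nmX; apply: lerXn2r; rewrite ?nnegrE ?nm_ge0 ?divr_ge0.
  split; first by apply: le_lt_trans (nm_div1B _) _; lra.
  by apply: contraTneq vN => ->; rewrite nm1 -ltNge; lra.
have case_z z : K z -> z ^+ N.+1 - rho%:C ^+ N.+1 != 0 /\
    nm ((if rho <= nm z then 1 else 0 : C) - z ^+ N.+1 / (z ^+ N.+1 - rho%:C ^+ N.+1)) < d.
  move=> /gap[z1|z1].
    have [|v1 v2] := vsmall (z / rho%:C).
      by rewrite nmM nmV nm_real gtr0_norm // ler_pdivrMr //; lra.
    have den : z ^+ N.+1 - rho%:C ^+ N.+1 != 0.
      rewrite subr_eq0; apply: contra v2 => /eqP zE.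
      by rewrite expr_div_n zE divff // expf_neq0.
    split => //; rewrite leNgt (le_lt_trans z1) /=; last lra.
    have -> : 0 - z ^+ N.+1 / (z ^+ N.+1 - rho%:C ^+ N.+1) =
        (z / rho%:C) ^+ N.+1 / (1 - (z / rho%:C) ^+ N.+1); last by [].
    rewrite expr_div_n; move: den; set s := z ^+ N.+1; set t := rho%:C ^+ N.+1 => den.
    have t0 : t != 0 by rewrite expf_neq0.
    have den' : t - s != 0 by rewrite -opprB oppr_eq0.
    by field; rewrite ?t0 ?den ?den'.
  have nz : 0 < nm z by lra.
  have z0 : z != 0 by rewrite -nm_gt0.
  have [|v1 v2] := vsmall (rho%:C / z).
    by rewrite nmM nmV nm_real gtr0_norm // ler_pdivrMr //; lra.
  have den : z ^+ N.+1 - rho%:C ^+ N.+1 != 0.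
    rewrite subr_eq0; apply: contra v2 => /eqP zE.
    by rewrite expr_div_n -zE divff // expf_neq0.
  split => //; rewrite (_ : rho <= nm z); last lra.
  rewrite -nmN.
  have -> : - (1 - z ^+ N.+1 / (z ^+ N.+1 - rho%:C ^+ N.+1)) =
      (rho%:C / z) ^+ N.+1 / (1 - (rho%:C / z) ^+ N.+1); last by [].
  rewrite expr_div_n; move: den; set s := z ^+ N.+1; set t := rho%:C ^+ N.+1 => den.
  have s0 : s != 0 by rewrite expf_neq0.
  by field; rewrite ?s0 ?den.
split=> [z Kz|z]; first by rewrite hornerD hornerN hornerC hornerXn; have [] := case_z _ Kz.
rewrite hornerD hornerN hornerC !hornerXn /H.
by have [] := case_z _ (set_val_in z).
Qed.

End Cutoffs.

(** * Failure of the smaller power at the centres *)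

Section Obstruction.
Variable R : realType.
Local Notation C := R[i].
Local Notation K := (@swiss_cheese R).
Implicit Types (z : C) (j : nat).
Local Notation pcenter j := (part_center R j).
Local Notation pradius j := (part_radius R j).
Local Notation hcenter j := (hole_center (pcenter j) (pradius j)).
Local Notation hradius j := (hole_radius (pcenter j) (pradius j) j.+1).

(** [B] is compact and covered by the open holes of the [j]-th disc; a finite subcover supplies the
    finite list that [lower_bound] requires. *)
Lemma finitely_many_holes j (B : set C^o) : closed B ->
  (forall z, B z -> nm (z - pcenter j) <= pradius j) -> (forall z, B z -> ~ K z) ->
  exists s : seq ((nat * nat * nat) * (nat * nat)),
    [/\ uniq s, {in s, forall x, hole_index R j x.1 x.2} &
      forall z, B z -> exists2 x, x \in s & nm (z - hcenter j x.1 x.2) < hradius j x.1 x.2].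
Proof.
move=> Bc Bs BK.
have : compact B.
  apply: closed_bounded_compact => // z /Bs /nm_part /andP[_]; rewrite /part_radius.
  by have := q_le1 R j; lra.
rewrite compact_cover => /(_ _ [set x : (nat * nat * nat) * (nat * nat) |
    hole_index R j x.1 x.2] (fun x => [set z : C^o |
    nm ((z : C) - hcenter j x.1 x.2) < hradius j x.1 x.2])).
case=> [x _|z Bz|D DI Dcov].
- exact: open_disc.
- apply: contrapT => nh; apply: (BK z Bz); apply: (swiss_cheese_part (Bs _ Bz)) => b h jbh.
  by rewrite leNgt; apply/negP => zh; apply: nh; exists (b, h).
exists (enum_fset D); split; first exact: fset_uniq.
  by move=> x /DI /set_mem.
by move=> z /Dcov[x xD zx]; exists x.
Qed.

Lemma monomial_in_ideal_power (x : K) n :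
  ideal_power (M_ideal (RK K) x) n (fun z : K => ((set_val z : C) - set_val x) ^+ n : C^o).
Proof.
exists 1%N, (fun=> 1), (fun _ => \prod_(i < n) (fun z : K => (set_val z : C) - set_val x : C^o)).
split.
  move=> _; exists (fun _ (z : K) => (set_val z : C) - set_val x : C^o); split => // _; split.
    have := @RK_rational R K ('X - (set_val x : C)%:P) 1.
    have -> : (fun z : K => ('X - (set_val x : C)%:P).[set_val z] / 1.[set_val z] : C^o) =
        (fun z : K => (set_val z : C) - set_val x).
      by apply/funext => z; rewrite hornerXsubC hornerC divr1.
    by apply => z _; rewrite hornerC oner_neq0.
  exact: subrr.
rewrite big_ord1 scale1r; apply/funext => z; rewrite fct_prodE /=.
by rewrite prodr_const card_ord.
Qed.

(** If (z - p)^(j+1) were a limit from J_x, a rational P / q would be near it on [K] and near 0 on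
    [K] around [p]. Both estimates persist off finitely many holes, and [lower_bound] then gives 1
    <= 3/4. *)
Lemma not_power_in_closure_center j (x : K) : set_val x = pcenter j ->
  ~ power_in_closure (RK K) x j.+1.
Proof.
move=> xj /(_ _ (monomial_in_ideal_power x j.+1))[_].
rewrite xj; set n := j.+1; set p := pcenter j; set s := pradius j.
move=> /uniform_closureP fJ.
have s0 : 0 < s := part_radius_gt0 R j; have s4 : s <= 4^-1 := part_radius_le R j.
pose A : R := (2 / s) ^+ n + 2 ^+ n.+1 / 16.
have A0 : 0 < A.
  apply: addr_gt0; first by apply: exprn_gt0; exact: divr_gt0.
  by apply: divr_gt0 => //; exact: exprn_gt0.
pose eps := (4 * A)^-1.
have eps0 : 0 < eps by rewrite invr_gt0; exact: mulr_gt0.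
have [g [gK /nbhs_subP[delta0 delta00 g0]] fg] := fJ _ eps0.
pose delta := Num.min (delta0 / 2) (s / 4).
have delta_gt0 : 0 < delta by rewrite lt_min; apply/andP; split; lra.
have delta_lt : delta < delta0.
  by apply: (@le_lt_trans _ _ (delta0 / 2)); rewrite ?ge_min ?lexx //; lra.
have delta_s : delta < s / 2.
  by apply: (@le_lt_trans _ _ (s / 4)); rewrite ?ge_min ?lexx ?orbT //; lra.
pose e' := Num.min eps ((delta / 2) ^+ n / 4).
have e'0 : 0 < e'.
  rewrite lt_min eps0; apply: divr_gt0 => //; apply: exprn_gt0; exact: divr_gt0.
move/RK_approx: gK => /(_ _ e'0)[P [q [qK gPq]]].
pose P1 := P - q * ('X - p%:P) ^+ n.
have P1E z : P1.[z] = P.[z] - q.[z] * (z - p) ^+ n by rewrite !hornerE.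
(* A closed disc in the shape demanded by [closed_poly_le]. *)
pose near r : set C^o := [set z | 1 * nm (('X - p%:P).[z]) <= nm ((r%:C)%:P.[z])].
have nearE r z : 0 <= r -> near r z <-> nm (z - p) <= r.
  by move=> r0; rewrite /near /= mul1r hornerXsubC hornerC nm_real ger0_norm.
(* The points where one of the two strict estimates fails. Zeros of [q] in the disc of radius [s]
   belong to [B], so [q] does not vanish on the rest of that disc. *)
pose B : set C^o := near s `&` ([set z | (eps + e') * nm q.[z] <= nm P1.[z]] `|`
  (near delta `&` [set z | e' * nm q.[z] <= nm P.[z]])).
have near_closed r : closed (near r).
  exact: closed_poly_le.
have [||z Bz Kz|l [ul lI lB]] := @finitely_many_holes j B.
- apply: closedI => //; apply: closedU.
    by apply: closed_poly_le; exact: ltW (addr_gt0 eps0 e'0).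
  by apply: closedI => //; apply: closed_poly_le; exact: ltW.
- by move=> z [/nearE h _]; apply: h; exact: ltW.
- pose y : K := SigSub (mem_set Kz).
  have yz : set_val y = z by [].
  have q0 := qK z Kz; have nq0 : 0 < nm q.[z] by rewrite nm_gt0.
  have := gPq y; have := fg y; rewrite yz => h1 h2.
  have PE : nm (P.[z] / q.[z] - (z - p) ^+ n) < eps + e'.
    have := nm_dist (P.[z] / q.[z]) (g y) ((z - p) ^+ n).
    by rewrite [X in _ <= X + _]nmC [X in _ <= _ + X]nmC; lra.
  case: Bz => _ [/=|[/nearE zd /=]].
    rewrite leNgt => /negP; apply; rewrite -ltr_pdivrMr // -nmV -nmM P1E mulrBl.
    by rewrite mulrAC divff // mul1r.
  rewrite leNgt => /negP; apply; rewrite -ltr_pdivrMr // -nmV -nmM.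
  have gy : g y = 0 by apply: g0; rewrite yz xj; apply: le_lt_trans delta_lt; apply: zd; exact: ltW.
  by move: h2; rewrite gy sub0r nmN.
pose discs := [seq (hcenter j x.1 x.2, hradius j x.1 x.2) | x <- l].
have out z : nm (z - p) <= s -> {in discs, forall d, d.2 <= nm (z - d.1)} -> ~ B z.
  move=> zs zd /lB[d dl]; apply/negP; rewrite -leNgt.
  exact: (zd (_, _) (map_f _ dl)).
have : 1 <= (eps + e') * A + e' * (2 / delta) ^+ n.
  apply: (@lower_bound R p n discs _ _ _ P q) => //.
  - by move=> _ /mapP[d /lI /andP[vd _] ->]; exact: hole_radius_gt0.
  - move=> _ /mapP[d /lI /andP[vd _] ->]; have [D0 D1 _] := hole_dist s0 s4 d.2 vd.
    by rewrite D0.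
  - rewrite big_map; apply: le_trans (@sums_le_hole_weight R l ul).
    rewrite big_seq [leRHS]big_seq; apply: ler_sum => -[b h] /lI /andP[vd hd].
    exact: hole_radius_weight.
  - exact: ltW (addr_gt0 eps0 e'0).
  - exact: ltW.
  - move=> z zs zd; have nB := out z zs zd.
    have : ~ ((eps + e') * nm q.[z] <= nm P1.[z]).
      by move=> h; apply: nB; split; [exact: (nearE s z (ltW s0)).2 zs | left].
    move/negP; rewrite -ltNge => h.
    have q0 : q.[z] != 0.
      by apply: contraTneq h => ->; rewrite nm0 mulr0 -leNgt nm_ge0.
    split => //; apply: ltW; move: h; rewrite -ltr_pdivrMr ?nm_gt0 // -nmV -nmM P1E mulrBl.
    by rewrite mulrAC divff // mul1r.
  - move=> z zd zo; have zs : nm (z - p) <= s by lra.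
    have nB := out z zs zo.
    have : ~ (e' * nm q.[z] <= nm P.[z]).
      move=> h; apply: nB; split; first exact: (nearE s z (ltW s0)).2 zs.
      by right; split => //; exact: (nearE delta z (ltW delta_gt0)).2 zd.
    move/negP; rewrite -ltNge => h.
    have q0 : q.[z] != 0.
      by apply: contraTneq h => ->; rewrite nm0 mulr0 -leNgt nm_ge0.
    by apply: ltW; move: h; rewrite -ltr_pdivrMr ?nm_gt0 // -nmV -nmM.
have eA : eps * A = 4^-1 by rewrite /eps invfM -mulrA mulVf ?mulr1 // gt_eqF.
have e'A : e' * A <= 4^-1 by rewrite -eA ler_pM2r // ge_min lexx.
have e'd : e' * (2 / delta) ^+ n <= 4^-1.
  have d2 : 0 < (delta / 2) ^+ n by apply: exprn_gt0; exact: divr_gt0.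
  rewrite -[2 / delta]invf_div exprVn ler_pdivrMr // mulrC.
  by rewrite ge_min lexx orbT.
by rewrite mulrDl eA; lra.
Qed.

End Obstruction.

Local Close Scope complex_scope.

Theorem corollary1p2 (R : realType) :
  exists K : set R[i]^o,
    [/\ compact_plane_set K,
        weakly_strongly_regular (RK K) &
        forall m : nat, (2 <= m)%N ->
          exists x : K,
            power_in_closure (RK K) x m /\
            ~ power_in_closure (RK K) x (m - 1)%N].
Proof.
exists (@swiss_cheese R); split; first exact: compact_plane_set_swiss_cheese.
  move=> x; have [[x0|[j xj]] _] := set_val_in x.
    by exists 1%N => //; exact: power_in_closure_zero.
  have [xp|xp] := pselect (set_val x = part_center R j).
    by exists j.+2 => //; exact: power_in_closure_center xp.
  by exists 5%N => //; exact: power_in_closure_generic xj xp.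
(* For m = j + 2 the witness is the centre p_j. *)
move=> [|[|j]] // _; exists (SigSub (mem_set (swiss_cheese_center R j))).
split; first exact: power_in_closure_center.
by rewrite subn1; exact: not_power_in_closure_center.
Qed.
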